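(* Let $a\neq\tfrac14$, $d=\tfrac14$, $b\neq0$ and $e=-b$. Then $\mathcal L=\mathcal L_{a,b,d,e}$ is a real Lie algebra of dimension $6$ with basis (where $\exp$ is the exponential function) \begin{align*} v_1&=b\exp(bt)x\,\partial_x+b\exp(bt)y\,\partial_y+\exp(bt)\partial_t-2b(-bx+a)\exp(bt)u\,\partial_u,\\ v_2&=-b\exp(-bt)x\,\partial_x-b\exp(-bt)y\,\partial_y+\exp(-bt)\partial_t+\tfrac12b(4by+1)\exp(-bt)u\,\partial_u,\\ v_3&=\partial_t+b(\tfrac14-a)u\,\partial_u,\qquad v_4=\sqrt y\exp(-\tfrac b2t)\partial_y-2b\sqrt y\exp(-\tfrac b2t)u\,\partial_u,\\ v_5&=\sqrt y\exp(\tfrac b2t)\partial_y,\qquad v_6=u\,\partial_u, \end{align*} and $\mathcal L\cong\mathcal M\cong\mathcal H_{0,0}$.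
   Context: All Lie algebras are real. For real constants $a,b,d,e$ consider the PDE $$\Delta:=(a-bx)u_x+(d-ey)u_y+\tfrac x2u_{xx}+\tfrac y2u_{yy}+u_t=0$$ for $u=u(x,y,t)$, $x,y>0$, $t\in\mathbb R$. An infinitesimal symmetry of the PDE is a smooth vector field $v=\xi\partial_x+\gamma\partial_y+\tau\partial_t+\phi\partial_u$ on $\{(x,y,t,u):x>0,y>0,t\in\mathbb R,u\in\mathbb R\}$, with $\xi,\gamma,\tau,\phi$ functions of $(x,y,t,u)$, whose second prolongation $\mathrm{pr}^{(2)}v$ satisfies $\mathrm{pr}^{(2)}v(\Delta)=0$ at all points of the second jet space where $\Delta=0$. $\mathcal V_{a,b,d,e}$ is the Lie algebra of all infinitesimal symmetries, under the Lie bracket of vector fields. For every $v\in\mathcal V_{a,b,d,e}$ the coefficient $\phi$ is affine in $u$: $\phi=\lambda_v(x,y,t)u+\mu_v(x,y,t)$. Set $\mathcal L_{a,b,d,e}=\{v\in\mathcal V_{a,b,d,e}:\mu_v=0\}$. $\mathcal M$ is the 6-dimensional real Lie algebra with basis $E,F,H,X,Y,Z$ and nonzero brackets (up to antisymmetry) $[E,F]=H$, $[H,E]=2E$, $[H,F]=-2F$, $[X,Y]=Z$, $[E,Y]=X$, $[F,X]=Y$, $[H,X]=X$, $[H,Y]=-Y$; thus $\mathcal M\cong\mathfrak{sl}_2\ltimes\mathfrak h_3$ with $\mathfrak h_3=\langle X,Y,Z\rangle$ the Heisenberg algebra. $\mathcal H_{0,0}$ is the 6-dimensional Lie symmetry algebra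 of the heat equation $\frac{\partial u}{\partial t}=-\frac{\partial^2u}{\partial q^2}$ for $u=u(t,q)$ (the symmetries coming from linear superposition of solutions being left out).
   Formalization: The added hypothesis a≠3/4 is needed: for a=3/4, d=1/4, e=-b the field √x·exp(-bt/2)∂_x − (1/(2√x))exp(-bt/2)u∂_u also lies in 𝓛 and is not in the span of v_1,…,v_6, so the printed claim fails there. *)

(* Defs.v *)
From mathcomp Require Export all_boot all_order all_algebra.
From mathcomp Require Export all_classical all_reals all_analysis.

Set Implicit Arguments.
Unset Strict Implicit.
Unset Printing Implicit Defensive.

Export Order.TTheory GRing.Theory Num.Theory numFieldNormedType.Exports.

Local Open Scope classical_set_scope.
Local Open Scope ring_scope.

(* A Lie algebra is given by a linear subspace A of an ambient vector space and
   an operation br on the ambient space, which only matters on A. *)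
Section LieAlgebras.
Variable R : realType.

Definition is_lie_algebra (V : lmodType R) (A : set V) (br : V -> V -> V) :=
  [/\ A 0,
      forall (c : R) u v, A u -> A v -> A (c *: u + v),
      forall u v, A u -> A v -> A (br u v),
      (forall (c : R) u v w, A u -> A v -> A w ->
         br (c *: u + v) w = c *: br u w + br v w /\
         br w (c *: u + v) = c *: br w u + br w v) &
      (forall u, A u -> br u u = 0) /\
      (forall u v w, A u -> A v -> A w ->
         br u (br v w) + br v (br w u) + br w (br u v) = 0)].

Definition lie_isomorphic (V W : lmodType R)
    (A : set V) (brA : V -> V -> V) (B : set W) (brB : W -> W -> W) :=
  [/\ is_lie_algebra A brA, is_lie_algebra B brB &
      exists f : V -> W,
        [/\ set_bij A B f,
            forall (c : R) u v, A u -> A v -> f (c *: u + v) = c *: f u + f v &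
            forall u v, A u -> A v -> f (brA u v) = brB (f u) (f v)]].

Definition is_basis (V : lmodType R) (A : set V) n (b : n.-tuple V) :=
  A = [set v | exists c : 'I_n -> R, v = \sum_(i < n) c i *: tnth b i] /\
  forall c : 'I_n -> R,
    \sum_(i < n) c i *: tnth b i = 0 -> forall i, c i = 0.

End LieAlgebras.

(* C^k on a (tacitly open) set D: all iterated directional derivatives of order
   at most k exist and are continuous at every point of D.  In finite dimension
   this is the usual notion; the values of f outside D do not matter. *)
Section Smooth.
Variables (R : realType) (V W : normedModType R).

Fixpoint is_Ck (k : nat) (D : set V) (f : V -> W) : Prop :=
  (forall p, D p -> {for p, continuous f}) /\
  if k is k'.+1 then
    forall v : V, (forall p, D p -> derivable f p v) /\ is_Ck k' D ('D_v f)
  else True.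

Definition smooth_on (D : set V) (f : V -> W) := forall k, is_Ck k D f.

End Smooth.

(* Symmetries of a scalar second order equation in n independent variables. *)
Section Symmetries.
Variables (R : realType) (n : nat).

(* jet0 : (x, u);  jet1 : ((x, u), (u_i));  jet2 : (((x, u), (u_i)), (u_ij)).
   A point of the second jet space is a j : jet2 whose matrix is symmetric. *)
Definition jet0 := ('rV[R]_n * R)%type.
Definition jet1 := (jet0 * 'rV[R]_n)%type.
Definition jet2 := (jet1 * 'M[R]_n)%type.

(* The value at z of the field sum_i xi^i d/dx_i + phi d/du is the pair
   (xi z, phi z). *)
Definition field := jet0 -> jet0.

Definition pdx (f : jet0 -> R) (i : 'I_n) : jet0 -> R :=
  'D_((delta_mx 0 i, 0) : jet0) f.

Definition pdu (f : jet0 -> R) : jet0 -> R := 'D_((0, 1) : jet0) f.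

Definition total0 (f : jet0 -> R) (i : 'I_n) (j : jet1) : R :=
  pdx f i j.1 + j.2 0 i * pdu f j.1.

Definition total1 (g : jet1 -> R) (i : 'I_n) (j : jet2) : R :=
  'D_(((delta_mx 0 i, 0), 0) : jet1) g j.1 +
  j.1.2 0 i * 'D_(((0, 1), 0) : jet1) g j.1 +
  \sum_(k < n) j.2 i k * 'D_(((0, 0), delta_mx 0 k) : jet1) g j.1.

Definition xi (v : field) (k : 'I_n) (z : jet0) : R := (v z).1 0 k.
Definition phi (v : field) (z : jet0) : R := (v z).2.

(* phi^i = D_i phi - sum_k (D_i xi^k) u_k *)
Definition phi1 (v : field) (i : 'I_n) (j : jet1) : R :=
  total0 (phi v) i j - \sum_(k < n) total0 (xi v k) i j * j.2 0 k.

(* phi^ij = D_j phi^i - sum_k (D_j xi^k) u_ik *)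
Definition phi2 (v : field) (i l : 'I_n) (j : jet2) : R :=
  total1 (phi1 v i) l j - \sum_(k < n) total0 (xi v k) l j.1 * j.2 i k.

(* The second prolongation, as a vector field on the second jet space. *)
Definition prolong2 (v : field) (j : jet2) : jet2 :=
  (v j.1.1, \row_i phi1 v i j.1, \matrix_(i, l) phi2 v i l j).

Definition over (Om : set 'rV[R]_n) : set jet0 := [set z | Om z.1].

(* A vector field on Om x R is encoded by its extension by zero, so that two
   fields are equal iff they agree on Om x R. *)
Definition vector_field (Om : set 'rV[R]_n) : set field :=
  [set v | smooth_on (over Om) v /\ forall z, ~ over Om z -> v z = 0].

Definition ext0 (Om : set 'rV[R]_n) (w : field) : field :=
  patch (cst 0) (over Om) w.

(* [v, w]^k = v(w^k) - w(v^k) *)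
Definition field_bracket (v w : field) : field :=
  fun z => 'D_(v z) w z - 'D_(w z) v z.

Definition symmetry (Om : set 'rV[R]_n) (Delta : jet2 -> R) : set field :=
  [set v | vector_field Om v /\
     forall j : jet2, over Om j.1.1 -> j.2^T = j.2 -> Delta j = 0 ->
       'D_(prolong2 v j) Delta j = 0].

(* Symmetries with phi = lambda u + mu and mu = 0, that is, the symmetries
   without those coming from the linear superposition of solutions. *)
Definition linear_symmetry (Om : set 'rV[R]_n) (Delta : jet2 -> R)
    : set field :=
  [set v | symmetry Om Delta v /\
     exists lambda : 'rV[R]_n -> R,
       forall z, over Om z -> phi v z = lambda z.1 * z.2].

End Symmetries.

Section Equations.
Variable R : realType.

(* Independent variables in the order (x, y, t). *)
Definition ix : 'I_3 := @Ordinal 3 0 isT.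
Definition iy : 'I_3 := @Ordinal 3 1 isT.
Definition it : 'I_3 := @Ordinal 3 2 isT.

Definition quadrant : set 'rV[R]_3 := [set p | 0 < p 0 ix /\ 0 < p 0 iy].

Definition Delta_abde (a b d e : R) (j : jet2 R 3) : R :=
  let x := j.1.1.1 0 ix in let y := j.1.1.1 0 iy in
  let p := j.1.2 in let H := j.2 in
  (a - b * x) * p 0 ix + (d - e * y) * p 0 iy
  + x / 2 * H ix ix + y / 2 * H iy iy + p 0 it.

Definition L_abde (a b d e : R) : set (field R 3) :=
  linear_symmetry quadrant (Delta_abde a b d e).

(* The heat equation u_t = - u_qq on R^2, independent variables (t, q). *)
Definition heat_t : 'I_2 := @Ordinal 2 0 isT.
Definition heat_q : 'I_2 := @Ordinal 2 1 isT.

Definition Delta_heat (j : jet2 R 2) : R :=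
  j.1.2 0 heat_t + j.2 heat_q heat_q.

Definition H00 : set (field R 2) := linear_symmetry setT Delta_heat.

(* The vector field xi d/dx + gamma d/dy + tau d/dt + phi d/du on
   x, y > 0, each coefficient being a function of x, y, t, u. *)
Definition field_xytu (xi gamma tau phi : R -> R -> R -> R -> R) : field R 3 :=
  ext0 quadrant (fun z =>
    let x := z.1 0 ix in let y := z.1 0 iy in let t := z.1 0 it in
    let u := z.2 in
    (\row_i nth 0 [:: xi x y t u; gamma x y t u; tau x y t u] i, phi x y t u)).

Definition v1 (a b : R) : field R 3 := field_xytu
  (fun x y t u => b * expR (b * t) * x)
  (fun x y t u => b * expR (b * t) * y)
  (fun x y t u => expR (b * t))
  (fun x y t u => - (2 * b * (- (b * x) + a) * expR (b * t) * u)).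

Definition v2 (b : R) : field R 3 := field_xytu
  (fun x y t u => - (b * expR (- (b * t)) * x))
  (fun x y t u => - (b * expR (- (b * t)) * y))
  (fun x y t u => expR (- (b * t)))
  (fun x y t u => 1 / 2 * b * (4 * b * y + 1) * expR (- (b * t)) * u).

Definition v3 (a b : R) : field R 3 := field_xytu
  (fun x y t u => 0)
  (fun x y t u => 0)
  (fun x y t u => 1)
  (fun x y t u => b * (1 / 4 - a) * u).

Definition v4 (b : R) : field R 3 := field_xytu
  (fun x y t u => 0)
  (fun x y t u => Num.sqrt y * expR (- (b / 2 * t)))
  (fun x y t u => 0)
  (fun x y t u => - (2 * b * Num.sqrt y * expR (- (b / 2 * t)) * u)).

Definition v5 (b : R) : field R 3 := field_xytu
  (fun x y t u => 0)
  (fun x y t u => Num.sqrt y * expR (b / 2 * t))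
  (fun x y t u => 0)
  (fun x y t u => 0).

Definition v6 : field R 3 := field_xytu
  (fun x y t u => 0)
  (fun x y t u => 0)
  (fun x y t u => 0)
  (fun x y t u => u).

(* M = sl_2 |x h_3 on R^6, the standard basis being E, F, H, X, Y, Z. *)
Definition M_basis (k : nat) : 'rV[R]_6 := delta_mx 0 (inord k).

(* Each nonzero bracket of basis vectors is listed in one order only. *)
Definition M_table (i j : nat) : 'rV[R]_6 :=
  let E := M_basis 0 in let F := M_basis 1 in let H := M_basis 2 in
  let X := M_basis 3 in let Y := M_basis 4 in let Z := M_basis 5 in
  match i, j with
  | 0%N, 1%N => H
  | 2%N, 0%N => 2 *: E
  | 2%N, 1%N => - 2 *: F
  | 3%N, 4%N => Z
  | 0%N, 4%N => X
  | 1%N, 3%N => Y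
  | 2%N, 3%N => X
  | 2%N, 4%N => - Y
  | _, _ => 0
  end.

Definition M_bracket (u v : 'rV[R]_6) : 'rV[R]_6 :=
  \sum_(i < 6) \sum_(j < 6) (u 0 i * v 0 j - u 0 j * v 0 i) *: M_table i j.

End Equations.

Arguments quadrant {R}.
Arguments H00 {R}.
Arguments v6 {R}.

(* Main.v *)
(* Let v be a symmetry. Comparing, on the jets that solve the equation, the
   coefficients of the mixed second derivatives shows that the components of v
   along the independent variables do not depend on u; the remaining
   coefficients are the determining equations. Those of the (x, y, t) equation
   give first X = x T' + sqrt x f(y, t) and lambda_x, hence lambda as a
   combination of x^(-1/2), 1, x^(1/2) and x. Substituting this into the last
   equation, the coefficient of x^(-3/2) is a multiple of
   (a - 1/4) (a - 3/4) f, so f = 0. Then Y = y T' + sqrt y g(t), and what is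
   left is T''' = b^2 T', g'' = b^2 g / 4 and a first order equation for the
   part of lambda depending on t only. No equality of mixed partial derivatives
   is needed. The heat equation is solved in the same way. In both cases the
   solutions form a family linear in w in R^6, and in a suitable basis the
   bracket of the fields of u and w is the field of their bracket in M. *)

(* In the coordinates sqrt x, sqrt y the second order part of the operator is 1/8 of the flat
   Laplacian. For d = 1/4 no singular first order term is left along sqrt y, while the one along
   sqrt x is conjugate to an inverse square potential proportional to (a - 1/4) (a - 3/4). Such a
   potential excludes translations along sqrt x and rotations of the plane of sqrt x and sqrt y.
   Both are encoded in f, so one vanishing statement removes them, whereas the translations g along
   sqrt y survive. The drifts turn into quadratic potentials proportional to b^2 x and e^2 y; since
   e = -b their frequencies agree, whence the common rates b and -b for T' and b/2 and -b/2 for g.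

   The obstacle is that T, f, g and lambda are arbitrary smooth functions, known only through
   directional derivatives, so coefficients of fractional powers cannot be compared formally. They
   are separated instead by evaluating identities at a few numerical values of sqrt x and sqrt y,
   after which only linear arithmetic remains. Conversely, the explicit solutions are given by
   syntax, so that checking the equations and brackets becomes computation. *)
Require Import Defs.
From mathcomp Require Import ring lra.

Set Implicit Arguments.
Unset Strict Implicit.
Unset Printing Implicit Defensive.

Local Open Scope classical_set_scope.
Local Open Scope ring_scope.

(** * Directional derivatives and smooth functions *)

Section DirectionalDerivatives.
Variable R : realType.
Implicit Types V W U : normedModType R.

(** The map g carries the line p + h v to the line g p + h w, so the two difference quotients are
    the same function. This chain rule needs only a directional derivative of f, where the general
    one would need a differential. *)
Lemma is_derive_comp_affine V W U (g : V -> W) (f : W -> U) p v w d :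
  (forall h : R, g (h *: v + p) = h *: w + g p) ->
  is_derive (g p) w f d -> is_derive p v (f \o g) d.
Proof.
move=> gE [fd fE].
have E : (fun h : R => h^-1 *: (((f \o g) \o shift p) (h *: v) - (f \o g) p)) =
    (fun h : R => h^-1 *: ((f \o shift (g p)) (h *: w) - f (g p))).
  by apply/funext => h /=; rewrite gE.
by split; [rewrite /derivable E|rewrite /derive E].
Qed.

Lemma is_derive_line V W (f : V -> W) p v d :
  is_derive p v f d <-> is_derive (0 : R) 1 (fun h : R => f (h *: v + p)) d.
Proof.
have E : (fun h : R => h^-1 *: ((f \o shift p) (h *: v) - f p)) =
    (fun h : R => h^-1 *: (((fun h : R => f (h *: v + p)) \o shift 0) (h *: (1 : R))
      - f (0 *: v + p))).
  by apply/funext => h /=; rewrite addr0 scale0r add0r /GRing.scale /= mulr1.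
split=> -[fd fE]; split.
- by move: fd; rewrite /derivable E.
- by move: fE; rewrite /derive E.
- by rewrite /derivable E.
- by rewrite /derive E.
Qed.

(** Along a line, the equations and the prolonged coefficients at a fixed base point are polynomials
    in h; their derivative is then the coefficient of h, and one [ring] call replaces the product
    rules. *)
Lemma is_derive_polynomial3 V (f : V -> R) p v c r s :
  (forall h : R, f (h *: v + p) = f p + h * c + h ^+ 2 * r + h ^+ 3 * s) ->
  is_derive p v f c.
Proof.
move=> fE; apply/is_derive_line.
rewrite (_ : (fun h => _) =
  (fun h : R => f p + h * c + h ^+ 2 * r + h ^+ 3 * s)); last exact/funext.
apply: is_derive_eq.
by rewrite /GRing.scale /=; ring.
Qed.

Lemma is_derive_linear V (l : V -> R) p v :
  (forall h v p, l (h *: v + p) = h * l v + l p) -> is_derive p v l (l v).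
Proof.
move=> lE; apply: (@is_derive_polynomial3 _ _ _ _ _ 0 0) => h.
by rewrite lE; ring.
Qed.

Lemma is_derive_scale (f : R -> R) (x c d : R) :
  is_derive x 1 f d -> is_derive x c f (c * d).
Proof.
move=> fd; apply/is_derive_line; rewrite mulrC.
apply: (@is_derive1_comp _ f (fun h => h *: c + x)).
  by rewrite scale0r add0r.
apply: (@is_derive_polynomial3 _ _ _ _ _ 0 0) => h; rewrite /GRing.scale /=; ring.
Qed.

Lemma eq_on_open_derive V W (D : set V) (f g : V -> W) p v :
  open D -> D p -> (forall q, D q -> f q = g q) -> 'D_v f p = 'D_v g p.
Proof.
move=> oD Dp fg; apply: near_eq_derive.
by near=> q; apply: fg; near: q; exact: open_nbhs_nbhs.
Unshelve. all: by end_near.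
Qed.

Lemma eq_on_open_derivable V W (D : set V) (f g : V -> W) p v :
  open D -> D p -> (forall q, D q -> f q = g q) ->
  derivable f p v -> derivable g p v.
Proof.
move=> oD Dp fg; apply: near_eq_derivable.
by near=> q; apply: fg; near: q; exact: open_nbhs_nbhs.
Unshelve. all: by end_near.
Qed.

(** Fields are extensions by zero and the formulas for their derivatives hold only on the open
    domain; this replaces a function by such a formula at every order of differentiation. *)
Lemma eq_on_open_Ck V W (D : set V) k (f g : V -> W) :
  open D -> (forall q, D q -> f q = g q) -> is_Ck k D f -> is_Ck k D g.
Proof.
move=> oD; elim: k f g => [|k IH] f g fg [fc fk]; split.
- move=> p Dp; rewrite /prop_for /continuous_at -(fg _ Dp).
  apply: cvg_trans (fc _ Dp); apply: near_eq_cvg.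
  by near=> q; apply/fg; near: q; exact: open_nbhs_nbhs.
- by [].
- move=> p Dp; rewrite /prop_for /continuous_at -(fg _ Dp).
  apply: cvg_trans (fc _ Dp); apply: near_eq_cvg.
  by near=> q; apply/fg; near: q; exact: open_nbhs_nbhs.
- move=> v; have [fd fC] := fk v; split.
    by move=> p Dp; exact: (eq_on_open_derivable oD Dp fg) (fd _ Dp).
  by apply: IH fC => q Dq; exact: eq_on_open_derive oD Dq fg.
Unshelve. all: by end_near.
Qed.

Lemma smooth_derive V W (D : set V) (f : V -> W) v :
  smooth_on D f -> smooth_on D ('D_v f).
Proof. by move=> fs k; have [_ /(_ v) []] := fs k.+1. Qed.

Lemma smooth_is_derive V W (D : set V) (f : V -> W) p v :
  smooth_on D f -> D p -> is_derive p v f ('D_v f p).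
Proof. by move=> fs Dp; split=> //; have [_ /(_ v) [fd _]] := fs 1%N; exact: fd. Qed.

Lemma is_derive_linear_comp V W U (l : W -> U) (f : V -> W) p v d :
  continuous l -> (forall (h : R) w w', l (h *: w + w') = h *: l w + l w') ->
  is_derive p v f d -> is_derive p v (l \o f) (l d).
Proof.
move=> lc lE [fd <-].
have lB w w' : l (w - w') = l w - l w'.
  by rewrite addrC -scaleN1r lE scaleN1r addrC.
have lZ (h : R) w : l (h *: w) = h *: l w.
  have l0 : l 0 = 0 by rewrite -(subrr 0) lB subrr.
  by rewrite -[h *: w]addr0 lE l0 addr0.
have E : (fun h : R => h^-1 *: (((l \o f) \o shift p) (h *: v) - (l \o f) p)) =
    l \o (fun h : R => h^-1 *: ((f \o shift p) (h *: v) - f p)).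
  by apply/funext => h /=; rewrite lZ lB.
have C : (h^-1 *: (((l \o f) \o shift p) (h *: v) - (l \o f) p)
    @[h --> 0^']) --> l ('D_v f p).
  rewrite E; apply: continuous_cvg; first exact: lc.
  exact: fd.
by split; [exact: cvgP C|exact: cvg_lim C].
Qed.

Lemma smooth_linear_comp V W U (D : set V) (l : W -> U) (f : V -> W) :
  open D ->
  continuous l -> (forall (h : R) w w', l (h *: w + w') = h *: l w + l w') ->
  smooth_on D f -> smooth_on D (l \o f).
Proof.
move=> oD lc lE fs k; elim: k f fs => [|k IH] f fs.
  by split=> // p Dp; apply: continuous_comp; [exact: (fs 0%N).1|exact: lc].
split=> [p Dp|v].
  by apply: continuous_comp; [exact: (fs 0%N).1|exact: lc].
have lD p : D p -> is_derive p v (l \o f) (l ('D_v f p)).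
  by move=> Dp; apply: is_derive_linear_comp => //; exact: smooth_is_derive.
split=> [p /lD []//|].
apply: (@eq_on_open_Ck _ _ _ _ (l \o 'D_v f)) => //.
  by move=> q /lD[] _ ->.
by apply: IH; exact: smooth_derive.
Qed.

(** Here g' is the linear part of g. The derivative of f \o g along v is the derivative of f along
    g' v, composed with g, hence again a smooth function composed with g, and the induction
    closes. *)
Lemma smooth_comp_affine V W U (D : set V) (D' : set W) (g : V -> W)
    (g' : V -> W) (f : W -> U) :
  open D -> continuous g -> (forall p, D p -> D' (g p)) ->
  (forall (h : R) v p, g (h *: v + p) = h *: g' v + g p) ->
  smooth_on D' f -> smooth_on D (f \o g).
Proof.
move=> oD gc gD gE fs k; elim: k f fs => [|k IH] f fs.
  split=> // p Dp; apply: continuous_comp; first exact: gc.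
  by apply: (fs 0%N).1; exact: gD.
split=> [p Dp|v].
  apply: continuous_comp; first exact: gc.
  by apply: (fs 0%N).1; exact: gD.
have lD p : D p -> is_derive p v (f \o g) ('D_(g' v) f (g p)).
  move=> Dp; apply: is_derive_comp_affine; first by move=> h; exact: gE.
  by apply: smooth_is_derive (gD _ Dp).
split=> [p /lD []//|].
apply: (@eq_on_open_Ck _ _ _ _ ('D_(g' v) f \o g)) => //.
  by move=> q /lD[] _ ->.
by apply: IH; exact: smooth_derive.
Qed.

Lemma derive0_constant_gt0 (f : R -> R) :
  (forall x : R, 0 < x -> is_derive x 1 f 0) ->
  forall x y : R, 0 < x -> 0 < y -> f x = f y.
Proof.
move=> f0.
suff H (x y : R) : 0 < x -> x < y -> f x = f y.
  move=> x y x0 y0; case: (ltgtP x y) => [xy|yx|->//]; first exact: H.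
  by apply/esym; exact: H.
move=> x0 xy.
have fc (z : R) : x <= z -> is_derive z 1 f 0.
  by move=> xz; apply: f0; exact: (lt_le_trans x0 xz).
have [||c _] := @MVT R f (fun=> 0) x y xy.
- by move=> z /[!in_itv]/= /andP[xz _]; apply: fc; exact: ltW.
- by apply: derivable_within_continuous => z /[!in_itv]/= /andP[xz _]; have [] := fc z xz.
- by move/eqP; rewrite mul0r subr_eq0 => /eqP.
Qed.

End DirectionalDerivatives.

(** * Differentiation of explicit functions *)

(* Expressions closed under differentiation, so that smoothness of the explicit
   fields is proved once and their derivatives are computed.  RSqrt i stands
   for the inverse of the square root of the i-th coordinate. *)
Inductive expr (R I : Type) :=
  | Cst of R
  | Crd of I
  | Add of expr R I & expr R I
  | Mul of expr R I & expr R I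
  | Exp of R & I
  | RSqrt of I.

Arguments Cst {R I}.
Arguments Crd {R I}.
Arguments RSqrt {R I}.

Declare Scope expr_scope.
Delimit Scope expr_scope with X.
Local Notation "e + f" := (Add e f) : expr_scope.
Local Notation "e * f" := (Mul e f) : expr_scope.
Local Notation "c %:C" := (Cst c%R) (at level 2, format "c %:C") : expr_scope.

Section Expressions.
Variables (R : realType) (I : Type).

Fixpoint eval (p : I -> R) (e : expr R I) : R :=
  match e with
  | Cst c => c
  | Crd i => p i
  | Add e f => eval p e + eval p f
  | Mul e f => eval p e * eval p f
  | Exp c i => expR (c * p i)
  | RSqrt i => (Num.sqrt (p i))^-1
  end.

(** The derivative of x^(-1/2) is - 1/2 times its cube. With the inverse root as primitive the
    syntax is therefore closed under [diff], and sqrt x is available as x * x^(-1/2). *)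
Fixpoint diff (v : I -> R) (e : expr R I) : expr R I :=
  match e with
  | Cst c => Cst 0
  | Crd i => Cst (v i)
  | Add e f => Add (diff v e) (diff v f)
  | Mul e f => Add (Mul (diff v e) f) (Mul e (diff v f))
  | Exp c i => Mul (Cst (c * v i)) (Exp c i)
  | RSqrt i => Mul (Cst (- v i / 2)) (Mul (RSqrt i) (Mul (RSqrt i) (RSqrt i)))
  end.

(* RSqrt is only applied to the coordinates satisfying pos. *)
Fixpoint wf (pos : pred I) (e : expr R I) : bool :=
  match e with
  | Add e f | Mul e f => wf pos e && wf pos f
  | RSqrt i => pos i
  | _ => true
  end.

Lemma wf_diff pos v e : wf pos e -> wf pos (diff v e).
Proof.
elim: e => //=.
- by move=> e IHe f IHf /andP[/IHe-> /IHf->].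
- by move=> e IHe f IHf /andP[we wf']; rewrite we wf' IHe ?IHf.
- by move=> i ->.
Qed.

Variables (V : normedModType R) (crd : I -> V -> R) (D : set V) (pos : pred I).
Hypothesis crd_linear :
  forall i (h : R) v p, crd i (h *: v + p) = h * crd i v + crd i p.
Hypothesis crd_continuous : forall i, continuous (crd i).
Hypothesis crd_pos : forall i p, pos i -> D p -> 0 < crd i p.
Hypothesis openD : open D.

Local Notation ev e p := (eval (crd^~ p) e).

Lemma is_derive_rsqrt (x : R) : 0 < x ->
  is_derive x 1 (fun x : R => (Num.sqrt x)^-1) (- 1 / 2 * (Num.sqrt x)^-1 ^+ 3).
Proof.
move=> x0; have sx0 : 0 < Num.sqrt x by rewrite sqrtr_gt0.
have d := is_derive1_sqrt x0.
have := @is_deriveV _ Num.sqrt x _ 1 (lt0r_neq0 sx0) d.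
move/is_derive_eq; apply; rewrite /GRing.scale /=; field; exact: lt0r_neq0.
Qed.

Lemma is_derive_eval e p v : D p -> wf pos e ->
  is_derive p v (fun q => ev e q) (ev (diff (crd^~ v) e) p).
Proof.
move=> Dp; elim: e => [c|i|e IHe f IHf|e IHe f IHf|c i|i] /=.
- by move=> _; exact: is_derive_cst.
- by move=> _; apply: is_derive_linear => h w q; exact: crd_linear.
- by case/andP=> /IHe de /IHf df; exact: is_deriveD.
- case/andP=> /IHe de /IHf df.
  apply: (is_derive_eq (is_deriveM de df)).
  by rewrite /GRing.scale /=; ring.
- move=> _; apply: (@is_derive_comp_affine _ _ _ _ (fun q => c * crd i q) expR p v
    (c * crd i v)).
    by move=> h /=; rewrite crd_linear /GRing.scale /=; ring.
  apply: is_derive_scale; exact: is_derive_expR.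
- move=> posi.
  apply: (@is_derive_comp_affine _ _ _ _ (crd i) (fun x => (Num.sqrt x)^-1) p v
    (crd i v)).
    by move=> h /=; rewrite crd_linear.
  apply: is_derive_eq.
    exact/is_derive_scale/is_derive_rsqrt/crd_pos.
  by ring.
Qed.

Lemma continuous_eval e p : D p -> wf pos e ->
  {for p, continuous (fun q => ev e q)}.
Proof.
move=> Dp; elim: e => [c|i|e IHe f IHf|e IHe f IHf|c i|i] /=.
- by move=> _; exact: cvg_cst.
- by move=> _; exact: crd_continuous.
- by case/andP=> /IHe de /IHf df; exact: cvgD.
- by case/andP=> /IHe de /IHf df; exact: cvgM.
- move=> _; apply: (@continuous_comp _ _ _ (fun q => c * crd i q) expR).
    by apply: cvgMr; exact: crd_continuous.
  exact: continuous_expR.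
- move=> posi; apply: cvgV.
    by rewrite lt0r_neq0// sqrtr_gt0 crd_pos.
  apply: (@continuous_comp _ _ _ (crd i) Num.sqrt).
    exact: crd_continuous.
  exact: sqrt_continuous.
Qed.

Lemma is_derive_eval_sum (W : normedModType R) m (e : 'I_m -> expr R I)
    (c : 'I_m -> W) p v : D p -> (forall i, wf pos (e i)) ->
  is_derive p v (fun q => \sum_(i < m) ev (e i) q *: c i)
    (\sum_(i < m) ev (diff (crd^~ v) (e i)) p *: c i).
Proof.
move=> Dp we.
have -> : (fun q => \sum_(i < m) ev (e i) q *: c i) =
    \sum_(i < m) (fun q => ev (e i) q *: c i).
  by apply/funext => q; rewrite fct_sumE.
apply: is_derive_sum => i.
apply: (@is_derive_linear_comp _ _ _ _ (fun x : R => x *: c i)).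
- by move=> x; apply: cvgZl; exact: cvg_id.
- by move=> h x y; rewrite scalerDl scalerA.
- exact: is_derive_eval.
Qed.

(** Vector valued maps are treated as sums of scalar expressions times constant vectors:
    differentiating the expressions gives a sum of the same form, so the induction on k stays inside
    the class. *)
Lemma smooth_eval_sum (W : normedModType R) m (e : 'I_m -> expr R I)
    (c : 'I_m -> W) : (forall i, wf pos (e i)) ->
  smooth_on D (fun q => \sum_(i < m) ev (e i) q *: c i).
Proof.
move=> we k; elim: k e we => [|k IH] e we.
  split=> // p Dp; rewrite /prop_for /continuous_at.
  by apply: cvg_big => [|i _]; [exact: add_continuous|apply: cvgZr_tmp; exact: continuous_eval].
split=> [p Dp|v].
  rewrite /prop_for /continuous_at.
  by apply: cvg_big => [|i _]; [exact: add_continuous|apply: cvgZr_tmp; exact: continuous_eval].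
split=> [p Dp|]; first by have [] := is_derive_eval_sum c v Dp we.
apply: eq_on_open_Ck (IH (fun i => diff (crd^~ v) (e i)) _) => //.
  by move=> q Dq; have [_ ->] := is_derive_eval_sum c v Dq we.
by move=> i; exact: wf_diff.
Qed.

End Expressions.

(** * Prolongation *)

Section Prolongation.
Variables (R : realType) (n : nat) (Om : set 'rV[R]_n).
Hypothesis openOm : open Om.

Definition partial (f : 'rV[R]_n -> R) (i : 'I_n) : 'rV[R]_n -> R :=
  'D_(delta_mx 0 i) f.

Lemma open_over : open (over Om).
Proof. by apply: open_comp => // z _; exact: cvg_fst. Qed.

Lemma open_over_jet1 : open [set j : jet1 R n | over Om j.1].
Proof. by apply: open_comp open_over => z _; exact: cvg_fst. Qed.

Lemma smooth_partial f i : smooth_on Om f -> smooth_on Om (partial f i).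
Proof. exact: smooth_derive. Qed.

Lemma eq_on_open_partial f g i p :
  Om p -> (forall q, Om q -> f q = g q) -> partial f i p = partial g i p.
Proof. by move=> Omp; exact: (eq_on_open_derive _ openOm Omp). Qed.

Lemma partial_eq0 f i p : Om p -> (forall q, Om q -> f q = 0) -> partial f i p = 0.
Proof.
move=> Omp f0; rewrite (@eq_on_open_partial _ (cst 0) _ _ Omp) //.
by rewrite /partial derive_cst.
Qed.

Lemma is_derive_base0 (f : 'rV[R]_n -> R) z w : smooth_on Om f -> over Om z ->
  is_derive z w (fun z : jet0 R n => f z.1) ('D_(w.1) f z.1).
Proof.
move=> fs Omz; apply: (@is_derive_comp_affine _ _ _ _ fst f) => //.
exact: smooth_is_derive.
Qed.

Lemma is_derive_base1 (f : 'rV[R]_n -> R) j w : smooth_on Om f -> over Om j.1 ->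
  is_derive j w (fun j : jet1 R n => f j.1.1) ('D_(w.1.1) f j.1.1).
Proof.
move=> fs Omj.
apply: (@is_derive_comp_affine _ _ _ _ (fun j : jet1 R n => j.1.1) f) => //.
exact: smooth_is_derive.
Qed.

Variables (X : 'I_n -> 'rV[R]_n -> R) (lam : 'rV[R]_n -> R) (v : field R n).
Hypotheses (X_smooth : forall k, smooth_on Om (X k))
  (lam_smooth : smooth_on Om lam).
Hypothesis vE : forall z, over Om z -> v z = (\row_k X k z.1, lam z.1 * z.2).

Lemma derive_xi k z w : over Om z -> 'D_w (xi v k) z = 'D_(w.1) (X k) z.1.
Proof.
move=> Omz.
rewrite (@eq_on_open_derive _ _ _ _ _ (fun z => X k z.1) _ _ open_over Omz).
  by have [] := is_derive_base0 w (X_smooth k) Omz.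
by move=> q Omq; rewrite /xi vE// mxE.
Qed.

Lemma derive_phi z w : over Om z ->
  'D_w (phi v) z = 'D_(w.1) lam z.1 * z.2 + lam z.1 * w.2.
Proof.
move=> Omz.
rewrite (@eq_on_open_derive _ _ _ _ _ (fun z => lam z.1 * z.2) _ _ open_over Omz);
  last by move=> q Omq; rewrite /phi vE.
have d2 : is_derive z w (fun z : jet0 R n => z.2) w.2.
  exact: (@is_derive_linear _ _ (fun z : jet0 R n => z.2)).
have [_ ->] := is_deriveM (is_derive_base0 w lam_smooth Omz) d2.
by rewrite /GRing.scale /=; ring.
Qed.

Lemma total0_xi k i j : over Om j.1 -> total0 (xi v k) i j = partial (X k) i j.1.1.
Proof.
by move=> Omj; rewrite /total0 /pdx /pdu !derive_xi//= derive0 mulr0 addr0.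
Qed.

Lemma phi1_fibre_linear i j : over Om j.1 ->
  phi1 v i j = partial lam i j.1.1 * j.1.2 + lam j.1.1 * j.2 0 i -
    \sum_k partial (X k) i j.1.1 * j.2 0 k.
Proof.
move=> Omj; rewrite /phi1 {1}/total0 /pdx /pdu !derive_phi//= derive0.
congr (_ - _); last by apply: eq_bigr => k _; rewrite total0_xi.
by rewrite /partial; ring.
Qed.

Lemma derive_phi1 i j w : over Om j.1 ->
  'D_w (phi1 v i) j =
    'D_(w.1.1) (partial lam i) j.1.1 * j.1.2 + partial lam i j.1.1 * w.1.2 +
    'D_(w.1.1) lam j.1.1 * j.2 0 i + lam j.1.1 * w.2 0 i -
    \sum_k ('D_(w.1.1) (partial (X k) i) j.1.1 * j.2 0 k +
            partial (X k) i j.1.1 * w.2 0 k).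
Proof.
move=> Omj.
rewrite (@eq_on_open_derive _ _ _ _ _ (fun j : jet1 R n =>
  partial lam i j.1.1 * j.1.2 + lam j.1.1 * j.2 0 i -
    \sum_k partial (X k) i j.1.1 * j.2 0 k) _ _ open_over_jet1 Omj); last first.
  by move=> q Omq; rewrite phi1_fibre_linear.
have du : is_derive j w (fun j : jet1 R n => j.1.2) w.1.2.
  exact: (@is_derive_linear _ _ (fun j : jet1 R n => j.1.2)).
have dp k : is_derive j w (fun j : jet1 R n => j.2 0 k) (w.2 0 k).
  apply: (@is_derive_linear _ _ (fun j : jet1 R n => j.2 0 k)) => h p q /=.
  by rewrite !mxE.
have dX k : is_derive j w (fun j : jet1 R n => partial (X k) i j.1.1 * j.2 0 k)
    ('D_(w.1.1) (partial (X k) i) j.1.1 * j.2 0 k + partial (X k) i j.1.1 * w.2 0 k).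
  have := is_deriveM (is_derive_base1 w (smooth_partial i (X_smooth k)) Omj) (dp k).
  by move/is_derive_eq; apply; rewrite /GRing.scale /=; ring.
have dl1 := is_deriveM (is_derive_base1 w (smooth_partial i lam_smooth) Omj) du.
have dl := is_deriveM (is_derive_base1 w lam_smooth Omj) (dp i).
have [_ E] := is_deriveB (is_deriveD dl1 dl) (is_derive_sum dX).
apply: etrans (etrans E _).
  by congr ('D_w _ j); apply/funext => q; rewrite !fctE fct_sumE.
by rewrite /GRing.scale /=; congr (_ - _); ring.
Qed.

(** The total derivative evaluates [derive_phi1] along the base, the u and the slope directions.
    First derivatives of X appear twice next to second derivatives of u: once from the slopes in
    phi^i, once from the correction term of phi^il. *)
Lemma phi2_fibre_linear i l j : over Om j.1.1 ->
  phi2 v i l j =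
    partial (partial lam i) l j.1.1.1 * j.1.1.2 +
    partial lam i j.1.1.1 * j.1.2 0 l + partial lam l j.1.1.1 * j.1.2 0 i +
    lam j.1.1.1 * j.2 l i -
    \sum_k (partial (partial (X k) i) l j.1.1.1 * j.1.2 0 k +
      partial (X k) i j.1.1.1 * j.2 l k + partial (X k) l j.1.1.1 * j.2 i k).
Proof.
move=> Omj.
have du k : 'D_(((0, 0), delta_mx 0 k) : jet1 R n) (phi1 v i) j.1 =
    lam j.1.1.1 * (k == i)%:R - partial (X k) i j.1.1.1.
  rewrite derive_phi1//= !derive0 (bigD1 k)//= big1 => [|m /negPf mk].
    by rewrite !derive0 !mxE !eqxx /= !mul0r mulr0 !add0r mulr1 addr0 eq_sym.
  by rewrite derive0 !mxE mk /= mul0r mulr0 addr0.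
have dx : 'D_(((delta_mx 0 l, 0), 0) : jet1 R n) (phi1 v i) j.1 =
    partial (partial lam i) l j.1.1.1 * j.1.1.2 + partial lam l j.1.1.1 * j.1.2 0 i
    - \sum_k partial (partial (X k) i) l j.1.1.1 * j.1.2 0 k.
  rewrite derive_phi1//= !mxE !mulr0 !addr0; congr (_ - _).
  by apply: eq_bigr => k _; rewrite mxE mulr0 addr0.
have d1 : 'D_(((0, 1), 0) : jet1 R n) (phi1 v i) j.1 = partial lam i j.1.1.1.
  rewrite derive_phi1//= !derive0 mxE big1 => [|k _].
    by rewrite !mul0r mulr0 mulr1 add0r !addr0 subr0.
  by rewrite derive0 mxE mul0r mulr0 addr0.
have dp : \sum_k j.2 l k * 'D_(((0, 0), delta_mx 0 k) : jet1 R n) (phi1 v i) j.1 =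
    lam j.1.1.1 * j.2 l i - \sum_k partial (X k) i j.1.1.1 * j.2 l k.
  rewrite (eq_bigr (fun k => lam j.1.1.1 * (j.2 l k * (k == i)%:R) -
    partial (X k) i j.1.1.1 * j.2 l k)) => [|k _]; last by rewrite du; ring.
  rewrite sumrB -mulr_sumr (bigD1 i)//= big1 => [|k /negPf ki]; last first.
    by rewrite ki mulr0.
  by rewrite eqxx mulr1 addr0.
rewrite /phi2 /total1 dx d1 dp !big_split /=.
rewrite [X in _ - X = _](eq_bigr (fun k => partial (X k) l j.1.1.1 * j.2 i k)).
  by ring.
by move=> k _; rewrite total0_xi.
Qed.

End Prolongation.

#[global] Opaque partial.

(** * Dependence of the prolongation on the second derivatives, for components that may depend on
    u *)

Section SecondOrderPart.
Variables (R : realType) (n : nat) (v : field R n).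

(** At a fixed base point phi^i is an explicit quadratic polynomial in the slopes, so no regularity
    of v is involved. The square comes from D_i xi^k, which contains u_i as soon as xi^k depends on
    u. *)
Lemma derive_phi1_slope i k (j : jet1 R n) :
  'D_(((0, 0), delta_mx 0 k) : jet1 R n) (phi1 v i) j =
  (k == i)%:R * (pdu (phi v) j.1 - \sum_m pdu (xi v m) j.1 * j.2 0 m)
  - total0 (xi v k) i j.
Proof.
have [_ ->//] : is_derive j (((0, 0), delta_mx 0 k) : jet1 R n) (phi1 v i)
  ((k == i)%:R * (pdu (phi v) j.1 - \sum_m pdu (xi v m) j.1 * j.2 0 m)
  - total0 (xi v k) i j).
apply: (@is_derive_polynomial3 _ _ _ _ _ _ (- (k == i)%:R * pdu (xi v k) j.1) 0) => h.
case: j => z p; rewrite /phi1 /total0 /= !scaler0 !add0r !mxE eqxx /= (eq_sym i k).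
set del := (k == i)%:R.
have sumE (f : 'I_n -> R) : \sum_m f m * (m == k)%:R = f k.
  rewrite (bigD1 k)//= big1 => [|m /negPf ->]; last by rewrite mulr0.
  by rewrite eqxx mulr1 addr0.
under eq_bigr => m _ do rewrite !mxE eqxx /=.
rewrite (eq_bigr (fun m =>
   (pdx (xi v m) i z + p 0 i * pdu (xi v m) z) * p 0 m +
   h * (del * (pdu (xi v m) z * p 0 m)) +
   h * ((pdx (xi v m) i z + p 0 i * pdu (xi v m) z) * (m == k)%:R) +
   h ^+ 2 * (del * (pdu (xi v m) z * (m == k)%:R)))); last by move=> m _; ring.
rewrite !big_split /= -!mulr_sumr !sumE.
ring.
Qed.

(** The part of phi^ii that is free of second derivatives. It is kept unevaluated, since it cancels
    when two jets with a suitable common part are compared. *)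
Definition phi2_base (i : 'I_n) (j : jet1 R n) : R :=
  'D_(((delta_mx 0 i, 0), 0) : jet1 R n) (phi1 v i) j +
  j.2 0 i * 'D_(((0, 1), 0) : jet1 R n) (phi1 v i) j.

Lemma phi2_diag i (j : jet1 R n) (H : 'M[R]_n) :
  phi2 v i i (j, H) = phi2_base i j + H i i * (pdu (phi v) j.1 -
    \sum_m pdu (xi v m) j.1 * j.2 0 m)
  - 2 * \sum_k H i k * total0 (xi v k) i j.
Proof.
rewrite /phi2 /total1 -/(phi2_base i j) /=.
set c := pdu (phi v) j.1 - _.
have -> : \sum_k H i k * 'D_(((0, 0), delta_mx 0 k) : jet1 R n) (phi1 v i) j =
    H i i * c - \sum_k H i k * total0 (xi v k) i j.
  rewrite (eq_bigr (fun k => H i k * (k == i)%:R * c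
    - H i k * total0 (xi v k) i j)); last first.
    by move=> k _; rewrite derive_phi1_slope -/c; ring.
  rewrite sumrB (bigD1 i)//= big1 => [|k /negPf ->]; last by rewrite mulr0 mul0r.
  by rewrite eqxx mulr1 addr0.
rewrite [X in _ - X = _](eq_bigr (fun k => H i k * total0 (xi v k) i j));
  last by move=> k _; rewrite mulrC.
by rewrite mulr_natl mulr2n opprD !addrA.
Qed.

Variable Om : set 'rV[R]_n.
Hypothesis openOm : open Om.
Hypothesis v_smooth : smooth_on (over Om) v.

Lemma smooth_xi k : smooth_on (over Om) (xi v k).
Proof.
apply: (@smooth_linear_comp _ _ _ _ _ (fun z : jet0 R n => z.1 0 k)) => //.
- exact: open_over.
- move=> z; apply: (@continuous_comp _ _ _ fst (fun p : 'rV[R]_n => p 0 k)).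
    exact: cvg_fst.
  exact: coord_continuous.
- by move=> h w w'; rewrite /= !mxE.
Qed.

Lemma smooth_phi : smooth_on (over Om) (phi v).
Proof.
apply: (@smooth_linear_comp _ _ _ _ _ (fun z : jet0 R n => z.2)) => //.
- exact: open_over.
- by move=> z; exact: cvg_snd.
Qed.

Lemma smooth_slice (f : jet0 R n -> R) u :
  smooth_on (over Om) f -> smooth_on Om (fun x => f (x, u)).
Proof.
apply: (@smooth_comp_affine _ _ _ _ _ _ (fun x => (x, u)) (fun x => (x, 0))) => //.
- move=> x; apply: (@cvg_pair _ _ _ (nbhs x) (nbhs x) (nbhs u) _ _ _ id (fun=> u)).
    exact: cvg_id.
  exact: (@cst_continuous _ _ u x).
- by move=> h w p; congr (_, _); rewrite /= scaler0 add0r.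
Qed.

Lemma pdu0_constant (f : jet0 R n -> R) : smooth_on (over Om) f ->
  (forall z, over Om z -> pdu f z = 0) ->
  forall z, over Om z -> f z = f (z.1, 0).
Proof.
move=> fs f0 [x u] Omx /=.
apply: (@is_derive_0_is_cst _ (fun u => f (x, u))) => s.
have d : is_derive ((x, s) : jet0 R n) (0, 1) f 0.
  by rewrite -(f0 (x, s) Omx); exact: smooth_is_derive fs _.
apply/is_derive_line; move/is_derive_line: d.
rewrite (_ : (fun h : R => _) = (fun h : R => f (x, h *: (1 : R) + s)))//.
by apply/funext => h; congr f; congr (_, _); rewrite /= scaler0 add0r.
Qed.

(** The function lambda comes without any regularity. Reading it off at u = 1, and the other
    components at u = 0, presents all coefficients as slices of smooth functions. *)
Lemma fibre_linear_coordinates lambda :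
  (forall k z, over Om z -> pdu (xi v k) z = 0) ->
  (forall z, over Om z -> phi v z = lambda z.1 * z.2) ->
  forall z, over Om z ->
    v z = (\row_k xi v k (z.1, 0), phi v (z.1, 1) * z.2).
Proof.
move=> xi0 phiE z Omz; rewrite phiE//= mulr1 -phiE//.
rewrite [LHS]surjective_pairing; congr (_, _).
apply/rowP => k; rewrite mxE -(pdu0_constant (smooth_xi k) (xi0 k))//.
Qed.

End SecondOrderPart.

(** * The equation in x, y, t *)

Section EquationXYT.
Variables (R : realType) (a b d e : R).

Lemma sum_xyt (V : nmodType) (f : 'I_3 -> V) : \sum_k f k = f ix + f iy + f it.
Proof.
rewrite !big_ord_recr big_ord0 /= add0r.
by congr (f _ + f _ + f _); apply/val_inj.
Qed.

Lemma open_quadrant : open (@quadrant R).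
Proof.
have o i : open [set p : 'rV[R]_3 | 0 < p 0 i].
  apply: (@open_comp _ _ (fun p : 'rV[R]_3 => p 0 i) [set x | 0 < x]).
    by move=> p _; exact: coord_continuous.
  exact: open_gt.
exact: openI (o ix) (o iy).
Qed.

Lemma derive_Delta_abde (j w : jet2 R 3) :
  'D_w (Delta_abde a b d e) j =
    - b * w.1.1.1 0 ix * j.1.2 0 ix + (a - b * j.1.1.1 0 ix) * w.1.2 0 ix
    - e * w.1.1.1 0 iy * j.1.2 0 iy + (d - e * j.1.1.1 0 iy) * w.1.2 0 iy
    + w.1.1.1 0 ix / 2 * j.2 ix ix + j.1.1.1 0 ix / 2 * w.2 ix ix
    + w.1.1.1 0 iy / 2 * j.2 iy iy + j.1.1.1 0 iy / 2 * w.2 iy iy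
    + w.1.2 0 it.
Proof.
apply/derive_val/(@is_derive_polynomial3 _ _ _ _ _ _
  (- b * w.1.1.1 0 ix * w.1.2 0 ix - e * w.1.1.1 0 iy * w.1.2 0 iy
   + w.1.1.1 0 ix / 2 * w.2 ix ix + w.1.1.1 0 iy / 2 * w.2 iy iy) 0) => h.
by rewrite /Delta_abde /= !mxE; field.
Qed.

(** The first group collects the coefficients of u_xt, u_yt, u_xy, u_xx and u_yy, the second those
    of u_x, u_y and u, after u_t has been eliminated by means of the equation. *)
Definition determining_xyt (X : 'I_3 -> 'rV[R]_3 -> R) (lam : 'rV[R]_3 -> R) :=
  forall p, quadrant p ->
  let x := p 0 ix in let y := p 0 iy in
  let A := a - b * x in let B := d - e * y in
  let T := X it in let Y := X iy in let X := X ix in let D := @partial R 3 in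
  [/\ D T ix p = 0, D T iy p = 0, x * D Y ix p + y * D X iy p = 0,
      X p - 2 * x * D X ix p + x * D T it p = 0 &
      Y p - 2 * y * D Y iy p + y * D T it p = 0] /\
  [/\ - b * X p + A * (D T it p - D X ix p) - B * D X iy p - D X it p
        + x * D lam ix p - x / 2 * D (D X ix) ix p - y / 2 * D (D X iy) iy p = 0,
      - e * Y p + B * (D T it p - D Y iy p) - A * D Y ix p - D Y it p
        + y * D lam iy p - x / 2 * D (D Y ix) ix p - y / 2 * D (D Y iy) iy p = 0 &
      D lam it p + A * D lam ix p + B * D lam iy p
        + x / 2 * D (D lam ix) ix p + y / 2 * D (D lam iy) iy p = 0].

(** The factor multiplied by K is the value of u_t on the equation. The other jet coordinates are
    free, so setting one of them to 1 and the rest to 0 isolates each coefficient. *)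
Lemma vanishing_coefficients (K A B x y c1 c2 c3 c4 c5 c6 c7 c8 : R) :
  (forall u px py hxx hyy hxy hxt hyt : R,
    K * - (A * px + B * py + x / 2 * hxx + y / 2 * hyy)
    + c1 * hxx + c2 * hyy - c3 * hxy - c4 * hxt - c5 * hyt
    + c6 * px + c7 * py + c8 * u = 0) ->
  [/\ c1 = x / 2 * K, c2 = y / 2 * K, c3 = 0, c4 = 0 & c5 = 0] /\
  [/\ c6 = A * K, c7 = B * K & c8 = 0].
Proof.
move=> E.
have e1 := E 0 0 0 1 0 0 0 0; have e2 := E 0 0 0 0 1 0 0 0.
have e3 := E 0 0 0 0 0 1 0 0; have e4 := E 0 0 0 0 0 0 1 0.
have e5 := E 0 0 0 0 0 0 0 1; have e6 := E 0 1 0 0 0 0 0 0.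
have e7 := E 0 0 1 0 0 0 0 0; have e8 := E 1 0 0 0 0 0 0 0.
by move=> {E}; do !split; lra.
Qed.

Section FibreLinear.
Variables (X : 'I_3 -> 'rV[R]_3 -> R) (lam : 'rV[R]_3 -> R) (v : field R 3).
Hypotheses (X_smooth : forall k, smooth_on quadrant (X k))
  (lam_smooth : smooth_on quadrant lam).
Hypothesis vE :
  forall z, over quadrant z -> v z = (\row_k X k z.1, lam z.1 * z.2).

(* K is the coefficient of u_t that is left when lam Delta is split off. *)
Lemma prolong_Delta_abde (j : jet2 R 3) : over quadrant j.1.1 -> j.2^T = j.2 ->
  let p := j.1.1.1 in let q := j.1.2 0 in let H := j.2 in
  let x := p 0 ix in let y := p 0 iy in
  let A := a - b * x in let B := d - e * y in
  let T := X it in let Y := X iy in let X := X ix in let D := @partial R 3 in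
  let K := - D T it p - A * D T ix p - B * D T iy p
    - x / 2 * D (D T ix) ix p - y / 2 * D (D T iy) iy p in
  'D_(prolong2 v j) (Delta_abde a b d e) j =
    lam p * Delta_abde a b d e j + K * q it
    + (X p / 2 - x * D X ix p) * H ix ix + (Y p / 2 - y * D Y iy p) * H iy iy
    - (x * D Y ix p + y * D X iy p) * H ix iy
    - x * D T ix p * H ix it - y * D T iy p * H iy it
    + (- b * X p - A * D X ix p - B * D X iy p - D X it p + x * D lam ix p
       - x / 2 * D (D X ix) ix p - y / 2 * D (D X iy) iy p) * q ix
    + (- e * Y p - A * D Y ix p - B * D Y iy p - D Y it p + y * D lam iy p
       - x / 2 * D (D Y ix) ix p - y / 2 * D (D Y iy) iy p) * q iy
    + (D lam it p + A * D lam ix p + B * D lam iy p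
       + x / 2 * D (D lam ix) ix p + y / 2 * D (D lam iy) iy p) * j.1.1.2.
Proof.
move=> Omj Hsym p q H x y A B T Y X' D K.
have Hyx : j.2 iy ix = j.2 ix iy by rewrite -{1}Hsym mxE.
rewrite derive_Delta_abde /prolong2 /= !mxE vE//= !mxE.
rewrite !(phi2_fibre_linear open_quadrant X_smooth lam_smooth vE)//.
rewrite !(phi1_fibre_linear open_quadrant X_smooth lam_smooth vE)//.
rewrite !sum_xyt Hyx /Delta_abde.
rewrite /K /A /B /T /Y /X' /D /x /y /p /q /H.
move: (partial) => D0.
by field.
Qed.

Definition row3 (x y t : R) : 'rV[R]_3 := \row_i nth 0 [:: x; y; t] i.

Definition hess3 (hxx hyy hxy hxt hyt : R) : 'M[R]_3 := \matrix_(i, k)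
  nth 0 (nth [::] [:: [:: hxx; hxy; hxt]; [:: hxy; hyy; hyt]; [:: hxt; hyt; 0]] i) k.

Lemma hess3_sym hxx hyy hxy hxt hyt :
  (hess3 hxx hyy hxy hxt hyt)^T = hess3 hxx hyy hxy hxt hyt.
Proof.
apply/matrixP => i k; rewrite !mxE.
by case: i k => [[|[|[|//]]] ?] [[|[|[|//]]] ?].
Qed.

(** The general jet on the equation, which is solved for u_t; u_tt is set to 0. *)
Definition solution_jet (p : 'rV[R]_3) (u px py hxx hyy hxy hxt hyt : R) : jet2 R 3 :=
  (((p, u), row3 px py (- ((a - b * p 0 ix) * px + (d - e * p 0 iy) * py
      + p 0 ix / 2 * hxx + p 0 iy / 2 * hyy))), hess3 hxx hyy hxy hxt hyt).

Lemma Delta_solution_jet p u px py hxx hyy hxy hxt hyt :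
  Delta_abde a b d e (solution_jet p u px py hxx hyy hxy hxt hyt) = 0.
Proof. by rewrite /Delta_abde /= !mxE /=; ring. Qed.

Lemma determining_xyt_symmetry : linear_symmetry quadrant (Delta_abde a b d e) v ->
  determining_xyt X lam.
Proof.
case=> -[_ vsym] _.
have E p : quadrant p -> forall u px py hxx hyy hxy hxt hyt : R,
    let x := p 0 ix in let y := p 0 iy in
    let A := a - b * x in let B := d - e * y in
    let T := X it in let Y := X iy in let X := X ix in let D := @partial R 3 in
    let K := - D T it p - A * D T ix p - B * D T iy p
      - x / 2 * D (D T ix) ix p - y / 2 * D (D T iy) iy p in
    K * - (A * px + B * py + x / 2 * hxx + y / 2 * hyy)
    + (X p / 2 - x * D X ix p) * hxx + (Y p / 2 - y * D Y iy p) * hyy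
    - (x * D Y ix p + y * D X iy p) * hxy
    - x * D T ix p * hxt - y * D T iy p * hyt
    + (- b * X p - A * D X ix p - B * D X iy p - D X it p + x * D lam ix p
       - x / 2 * D (D X ix) ix p - y / 2 * D (D X iy) iy p) * px
    + (- e * Y p - A * D Y ix p - B * D Y iy p - D Y it p + y * D lam iy p
       - x / 2 * D (D Y ix) ix p - y / 2 * D (D Y iy) iy p) * py
    + (D lam it p + A * D lam ix p + B * D lam iy p
       + x / 2 * D (D lam ix) ix p + y / 2 * D (D lam iy) iy p) * u = 0.
  move=> Omp u px py hxx hyy hxy hxt hyt /=.
  have := vsym (solution_jet p u px py hxx hyy hxy hxt hyt) Omp
    (hess3_sym _ _ _ _ _) (Delta_solution_jet _ _ _ _ _ _ _ _ _).
  rewrite prolong_Delta_abde ?Delta_solution_jet//; last exact: hess3_sym.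
  by rewrite mulr0 add0r /= !mxE.
have T0 p : quadrant p -> partial (X it) ix p = 0 /\ partial (X it) iy p = 0.
  move=> Omp; have [x0 y0] := Omp.
  have [[_ _ _ /eqP c4 /eqP c5] _] := vanishing_coefficients (E p Omp).
  move: c4 c5; rewrite !mulf_eq0 (gt_eqF x0) (gt_eqF y0).
  by move=> /eqP -> /eqP ->.
(* Since T_x and T_y vanish on the whole quadrant, they may be differentiated once more; the factor
   K then reduces to - T_t. *)
have T00 p : quadrant p -> partial (partial (X it) ix) ix p = 0 /\
    partial (partial (X it) iy) iy p = 0.
  by move=> Omp; split;
    apply: (@partial_eq0 _ _ _ open_quadrant _ _ _ Omp) => q /T0[].
move=> p Omp /=; have [Tx Ty] := T0 p Omp; have [Txx Tyy] := T00 p Omp.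
have [[e1 e2 e3 _ _] [e4 e5 e6]] := vanishing_coefficients (E p Omp).
move: e1 e2 e3 e4 e5 e6; rewrite Tx Ty Txx Tyy.
move: (@partial R 3) => D.
move: (p 0 ix) (p 0 iy) (X ix p) (X iy p) (D (X it) it p) (D (X ix) ix p)
  (D (X ix) iy p) (D (X ix) it p) (D (X iy) ix p) (D (X iy) iy p)
  (D (X iy) it p) (D lam ix p) (D lam iy p) (D lam it p)
  (D (D (X ix) ix) ix p) (D (D (X ix) iy) iy p) (D (D (X iy) ix) ix p)
  (D (D (X iy) iy) iy p) (D (D lam ix) ix p) (D (D lam iy) iy p).
move=> {E T0 T00 Txx Tyy Tx Ty vsym}.
by move=> *; split; split => //; lra.
Qed.

Lemma symmetry_determining_xyt : vector_field quadrant v ->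
  determining_xyt X lam -> linear_symmetry quadrant (Delta_abde a b d e) v.
Proof.
move=> vv det; split; last first.
  by exists lam => z Omz; rewrite /phi vE.
split=> // j Omj Hsym j0; rewrite prolong_Delta_abde// j0.
have T0 p : quadrant p -> partial (X it) ix p = 0 /\ partial (X it) iy p = 0.
  by move=> /det [[]].
have T00 p : quadrant p -> partial (partial (X it) ix) ix p = 0 /\
    partial (partial (X it) iy) iy p = 0.
  by move=> Omp; split;
    apply: (@partial_eq0 _ _ _ open_quadrant _ _ _ Omp) => q /T0[].
have [] := det _ Omj; have [Txx Tyy] := T00 _ Omj.
move=> [-> -> e1 e2 e3] [e4 e5 e6]; rewrite Txx Tyy.
(* On the equation, the prolonged field applied to Delta is - T_t Delta plus each determining
   equation times its own jet coordinate. The following lines scale these equations and add them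
   up. *)
have {}E : - partial (X it) it j.1.1.1 * Delta_abde a b d e j = 0.
  by rewrite j0 mulr0.
move: E; rewrite /Delta_abde.
have F c E' : E' = 0 -> c * E' = 0 :> R by move=> ->; rewrite mulr0.
move/(F (j.2 ix ix / 2)): e2; move/(F (j.2 iy iy / 2)): e3.
move/(F (- j.2 ix iy)): e1; move/(F (j.1.2 0 ix)): e4.
move/(F (j.1.2 0 iy)): e5; move/(F (j.1.1.2)): e6.
have G (s1 s2 s3 s4 s5 s6 s7 : R) : s1 = 0 -> s2 = 0 -> s3 = 0 -> s4 = 0 ->
    s5 = 0 -> s6 = 0 -> s7 = 0 -> s1 + s2 + s3 + s4 + s5 + s6 + s7 = 0.
  by move=> -> -> -> -> -> -> ->; rewrite !addr0.
move=> e6 e5 e4 e1 e3 e2 e0.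
apply: etrans _ (G _ _ _ _ _ _ _ e0 e1 e2 e3 e4 e5 e6).
move: (@partial R 3) => D.
by field.
Qed.
End FibreLinear.
End EquationXYT.

Lemma ord_xyt (k : 'I_3) : [\/ k = ix, k = iy | k = it].
Proof.
by case: k => [[|[|[|//]]] kn]; [apply: Or31|apply: Or32|apply: Or33];
  apply/val_inj.
Qed.

(** * The components along x, y and t do not depend on u *)

Section FibreConstantXYT.
Variables (R : realType) (a b d e : R) (v : field R 3).
Hypothesis v_sym : symmetry quadrant (Delta_abde a b d e) v.

Lemma mixed_coefficients p u px py : quadrant p ->
  let j := (solution_jet a b d e p u px py 0 0 0 0 0).1 in
  let x := p 0 ix in let y := p 0 iy in let D k i := total0 (xi v k) i j in
  [/\ x * D iy ix + y * D ix iy = 0, D it ix = 0 & D it iy = 0].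
Proof.
move=> Omp j x y D; have [x0 y0] := Omp.
(* The numbers c1, c2, c3 are u_xy, u_xt, u_yt. Changing them leaves the equation satisfied, so the
   symmetry conditions at this jet and at the one with zero Hessian can be subtracted; everything of
   lower order cancels. *)
have E (c1 c2 c3 : R) :
    x * (c1 * D iy ix + c2 * D it ix) + y * (c1 * D ix iy + c3 * D it iy) = 0.
  have vj H : H^T = H -> H ix ix = 0 -> H iy iy = 0 ->
      'D_(prolong2 v (j, H)) (Delta_abde a b d e) (j, H) = 0.
    move=> sH Hx Hy; have [_ vs] := v_sym; apply: vs => //.
    by rewrite /Delta_abde /= Hx Hy !mxE /=; ring.
  have := vj (hess3 0 0 c1 c2 c3) (hess3_sym _ _ _ _ _).
  have := vj (hess3 0 0 0 0 0) (hess3_sym _ _ _ _ _).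
  rewrite !derive_Delta_abde /prolong2 /= !mxE.
  rewrite !(phi2_diag v _ j).
  rewrite !sum_xyt !mxE /=.
  rewrite -/x -/y -!/(D _ _).
  move=> /(_ erefl erefl) e1 /(_ erefl erefl) e2.
  have F (s1 s2 : R) : s1 = 0 -> s2 = 0 -> s1 - s2 = 0.
    by move=> -> ->; rewrite subr0.
  apply: etrans _ (F _ _ e1 e2); clearbody D.
  move: (phi2_base v ix j) (phi2_base v iy j) => A B.
  by field.
have e1 := E 1 0 0; have e2 := E 0 1 0; have e3 := E 0 0 1.
move: e1 e2 e3; rewrite !mul0r !mul1r !addr0 !add0r !mulr0 !add0r !addr0.
move=> -> /eqP e2 /eqP e3; move: e2 e3.
by rewrite !mulf_eq0 (gt_eqF x0) (gt_eqF y0) => /eqP -> /eqP ->.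
Qed.

(** A total derivative is affine in the slope, with the u-derivative as leading coefficient.
    Comparing the slopes (0, 0), (1, 0) and (0, 1) in the mixed coefficients isolates it. *)
Lemma symmetry_pdu0_xyt k z : over quadrant z -> pdu (xi v k) z = 0.
Proof.
case: z => p u Omp; have [x0 y0] := Omp.
have [a1 b1 c1] := mixed_coefficients u 0 0 Omp.
have [a2 b2 _] := mixed_coefficients u 1 0 Omp.
have [a3 _ _] := mixed_coefficients u 0 1 Omp.
have [Ux Uy Ut] : [/\ pdu (xi v ix) (p, u) = 0, pdu (xi v iy) (p, u) = 0 &
    pdu (xi v it) (p, u) = 0].
  move: a1 b1 a2 b2 a3 x0 y0; rewrite /total0 /= !mxE /=.
  move: (pdu (xi v it) _) (pdu (xi v iy) _) (pdu (xi v ix) _)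
    (pdx (xi v ix) _ _) (pdx (xi v iy) _ _) (pdx (xi v it) _ _) (p 0 ix) (p 0 iy).
  move=> Ut Uy Ux X Y T x y a1 b1 a2 b2 a3 x0 y0.
  have /eqP : x * Uy = 0 by lra.
  have /eqP : y * Ux = 0 by lra.
  rewrite !mulf_eq0 (gt_eqF x0) (gt_eqF y0) => /eqP Ux0 /eqP Uy0.
  by split => //; lra.
by case: (ord_xyt k) => ->.
Qed.

End FibreConstantXYT.

Lemma L_abde_fibre_linear (R : realType) (a b d e : R) (v : field R 3) :
  L_abde a b d e v ->
  exists (X : 'I_3 -> 'rV[R]_3 -> R) (lam : 'rV[R]_3 -> R),
  [/\ forall k, smooth_on quadrant (X k), smooth_on quadrant lam,
    (forall z, over quadrant z -> v z = (\row_k X k z.1, lam z.1 * z.2)) &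
    determining_xyt a b d e X lam].
Proof.
move=> Lv; have [vs [mu muE]] := Lv; have [[v_smooth _] _] := vs.
have oq := @open_quadrant R.
have xi0 k z := @symmetry_pdu0_xyt _ _ _ _ _ _ vs k z.
have vE := fibre_linear_coordinates oq v_smooth xi0 muE.
exists (fun k x => xi v k (x, 0)), (fun x => phi v (x, 1)).
have Xs k : smooth_on quadrant (fun x => xi v k (x, 0)).
  exact: (smooth_slice oq 0 (smooth_xi oq v_smooth k)).
have ls : smooth_on quadrant (fun x => phi v (x, 1)).
  exact: (smooth_slice oq 1 (smooth_phi oq v_smooth)).
by split=> //; exact: determining_xyt_symmetry Xs ls vE Lv.
Qed.

(** * Differential equations and primitives in one variable *)

Section OneVariable.
Variable R : realType.
Implicit Types (f g : R -> R) (x y c : R).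

Lemma is_derive_unique_gt0 f g x c c' : 0 < x ->
  (forall z, 0 < z -> f z = g z) ->
  is_derive x 1 f c -> is_derive x 1 g c' -> c = c'.
Proof.
move=> x0 fg [_ <-] [_ <-].
exact: (@eq_on_open_derive R _ _ [set z : R | 0 < z] f g x 1 (@open_gt R 0) x0 fg).
Qed.

Lemma is_derive_unique f g x c c' : f =1 g ->
  is_derive x 1 f c -> is_derive x 1 g c' -> c = c'.
Proof. by move=> /funext -> [_ <-] [_ <-]. Qed.

Lemma derive0_constant f : (forall x, is_derive x 1 f 0) -> forall x, f x = f 0.
Proof. by move=> f0 x; exact: is_derive_0_is_cst. Qed.

Lemma is_derive_mulr f x c d : is_derive x 1 f d ->
  is_derive x 1 (fun z => f z * c) (d * c).
Proof.
move=> fd; have := is_deriveM fd (is_derive_cst c x 1).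
by move/is_derive_eq; apply; rewrite /GRing.scale /=; ring.
Qed.

Lemma is_derive_expR_scale c x : is_derive x 1 (fun z => expR (c * z)) (c * expR (c * x)).
Proof.
rewrite mulrC.
apply: (@is_derive1_comp R expR (fun z => c * z)).
apply: (@is_derive_polynomial3 _ _ _ _ _ c 0 0) => h; rewrite /GRing.scale /=; ring.
Qed.

Lemma linear_ode f c : (forall x, is_derive x 1 f (c * f x)) ->
  forall x, f x = f 0 * expR (c * x).
Proof.
move=> fd x.
have d (z : R) : is_derive z 1 (fun z => f z * expR (- c * z)) 0.
  have := is_deriveM (fd z) (is_derive_expR_scale (- c) z).
  by move/is_derive_eq; apply; rewrite /GRing.scale /=; ring.
have := derive0_constant d x; rewrite mulr0 expR0 mulr1 mulNr => <-.
by rewrite -mulrA -expRD addNr expR0 mulr1.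
Qed.

(* Values of functions of x > 0 are given at x = p ^+ 2, which makes the
   fractional powers of x rational in p. *)
Lemma first_order_in_x f df c : (forall x, 0 < x -> is_derive x 1 f (df x)) ->
  (forall x, 0 < x -> f x - 2 * x * df x + x * c = 0) ->
  forall p, 0 < p -> f (p ^+ 2) = p ^+ 2 * c + p * (f 1 - c).
Proof.
move=> fd fE p p0.
(* The function x c is a particular solution and sqrt x solves the homogeneous equation f = 2 x f',
   so this quotient is constant. *)
pose h x := (f x - x * c) * (Num.sqrt x)^-1.
have hd (x : R) : 0 < x -> is_derive x 1 h 0.
  move=> x0; have := is_deriveM (is_deriveB (fd x x0) (is_derive_mulr c (is_derive_id x 1)))
    (is_derive_rsqrt x0).
  move/is_derive_eq; apply; rewrite /GRing.scale /= !fctE.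
  have s0 : Num.sqrt x != 0 by rewrite lt0r_neq0// sqrtr_gt0.
  have fx : f x = 2 * x * df x - x * c by have := fE x x0; lra.
  rewrite fx; move: (df x) (Num.sqrt x) s0 (sqr_sqrtr (ltW x0)) => D s s0 <-.
  by field.
have p20 : 0 < p ^+ 2 by rewrite exprn_gt0.
have := derive0_constant_gt0 hd p20 ltr01.
rewrite /h sqrtr_sqr gtr0_norm// sqrtr1 invr1 mulr1 mul1r => <-.
field; exact: lt0r_neq0.
Qed.

(** The ansatz alpha + G x^(-1/2) + kappa x^(-3/2) is the shape taken by lambda_x, and with kappa =
    0 by lambda_y and X_x. *)
Lemma derivative_sqrt df ddf alpha G kappa :
  (forall x, 0 < x -> is_derive x 1 df (ddf x)) ->
  (forall p, 0 < p -> df (p ^+ 2) = alpha + G / p + kappa / p ^+ 3) ->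
  forall p, 0 < p -> ddf (p ^+ 2) = - G / (2 * p ^+ 3) - 3 * kappa / (2 * p ^+ 5).
Proof.
move=> fd fE p p0; have p20 : 0 < p ^+ 2 by rewrite exprn_gt0.
have r := is_derive_rsqrt p20.
have r3 := is_deriveM r (is_deriveM r r).
have d := is_deriveD (is_deriveD (is_derive_cst alpha (p ^+ 2) 1) (is_deriveZ G r))
  (is_deriveZ kappa r3).
have H z : 0 < z -> df z = (cst alpha + G \*: (fun z => (Num.sqrt z)^-1) +
    kappa \*: ((fun z => (Num.sqrt z)^-1) * ((fun z => (Num.sqrt z)^-1) *
      (fun z => (Num.sqrt z)^-1)))) z.
  move=> z0; have s0 : 0 < Num.sqrt z by rewrite sqrtr_gt0.
  rewrite -{1}[z](sqr_sqrtr (ltW z0)) fE// !fctE /GRing.scale /= /GRing.scale /=.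
  by field; exact: lt0r_neq0.
rewrite (is_derive_unique_gt0 p20 H (fd _ p20) d) /GRing.scale /= !fctE /GRing.scale /=.
rewrite sqrtr_sqr gtr0_norm//.
by field; exact: lt0r_neq0.
Qed.

(** Integrating the ansatz yields only multiples of x, sqrt x, 1/sqrt x and 1: these are the powers
    that occur in lambda. *)
Lemma antiderivative_sqrt f df alpha G kappa :
  (forall x, 0 < x -> is_derive x 1 f (df x)) ->
  (forall p, 0 < p -> df (p ^+ 2) = alpha + G / p + kappa / p ^+ 3) ->
  forall p, 0 < p -> f (p ^+ 2) - f 1 =
    alpha * (p ^+ 2 - 1) + 2 * G * (p - 1) - 2 * kappa * (p^-1 - 1).
Proof.
move=> fd fE p p0.
pose h x := f x - (alpha * x + 2 * G * Num.sqrt x - 2 * kappa * (Num.sqrt x)^-1).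
have hd (x : R) : 0 < x -> is_derive x 1 h 0.
  move=> x0.
  have s0 : 0 < Num.sqrt x by rewrite sqrtr_gt0.
  have d1 := is_deriveZ alpha (is_derive_id x 1).
  have d2 := is_deriveZ (2 * G) (is_derive1_sqrt x0).
  have d3 := is_deriveZ (2 * kappa) (is_derive_rsqrt x0).
  have := is_deriveB (fd x x0) (is_deriveB (is_deriveD d1 d2) d3).
  move/is_derive_eq; apply; rewrite /GRing.scale /=.
  have := fE _ s0; rewrite sqr_sqrtr ?ltW// => ->.
  field; exact: lt0r_neq0.
have p20 : 0 < p ^+ 2 by rewrite exprn_gt0.
have := derive0_constant_gt0 hd p20 ltr01.
rewrite /h sqrtr_sqr gtr0_norm// sqrtr1 invr1 => E.
by lra.
Qed.

Lemma first_order_in_x_derivatives f df ddf c :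
  (forall x, 0 < x -> is_derive x 1 f (df x)) ->
  (forall x, 0 < x -> is_derive x 1 df (ddf x)) ->
  (forall x, 0 < x -> f x - 2 * x * df x + x * c = 0) ->
  forall p, 0 < p -> df (p ^+ 2) = c + (f 1 - c) / (2 * p) /\
    ddf (p ^+ 2) = - (f 1 - c) / (4 * p ^+ 3).
Proof.
move=> fd dfd fE.
have dfE p : 0 < p -> df (p ^+ 2) = c + (f 1 - c) / 2 / p + 0 / p ^+ 3.
  move=> p0; have p20 : 0 < p ^+ 2 by rewrite exprn_gt0.
  have := fE _ p20; rewrite (first_order_in_x fd fE p0) => E.
  have -> : df (p ^+ 2) = (2 * p ^+ 2 * df (p ^+ 2)) / (2 * p ^+ 2).
    by field; exact: lt0r_neq0.
  have -> : 2 * p ^+ 2 * df (p ^+ 2) = p ^+ 2 * c + p * (f 1 - c) + p ^+ 2 * c by lra.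
  by field; exact: lt0r_neq0.
move=> p p0; rewrite dfE// (derivative_sqrt dfd dfE p0).
by split; field; exact: lt0r_neq0.
Qed.
End OneVariable.

(** * Restriction to lines parallel to the coordinate axes *)

Section Slices.
Variable R : realType.
Implicit Types (F : 'rV[R]_3 -> R) (x y t : R).

Lemma quadrant_row3 x y t : 0 < x -> 0 < y -> quadrant (row3 x y t).
Proof. by move=> x0 y0; split; rewrite mxE. Qed.

Lemma is_derive_in_x F x y t : smooth_on quadrant F -> 0 < x -> 0 < y ->
  is_derive x 1 (fun x => F (row3 x y t)) (partial F ix (row3 x y t)).
Proof.
move=> Fs x0 y0.
apply: (@is_derive_comp_affine _ _ _ _ (fun x => row3 x y t) F _ _ (delta_mx 0 ix)).
  move=> h; apply/rowP => k; rewrite !mxE.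
  by case: (ord_xyt k) => -> /=; rewrite ?mulr0 ?mulr1 ?add0r // /GRing.scale /= mulr1.
exact: (smooth_is_derive _ Fs (quadrant_row3 t x0 y0)).
Qed.

Lemma is_derive_in_y F x y t : smooth_on quadrant F -> 0 < x -> 0 < y ->
  is_derive y 1 (fun y => F (row3 x y t)) (partial F iy (row3 x y t)).
Proof.
move=> Fs x0 y0.
apply: (@is_derive_comp_affine _ _ _ _ (fun y => row3 x y t) F _ _ (delta_mx 0 iy)).
  move=> h; apply/rowP => k; rewrite !mxE.
  by case: (ord_xyt k) => -> /=; rewrite ?mulr0 ?mulr1 ?add0r // /GRing.scale /= mulr1.
exact: (smooth_is_derive _ Fs (quadrant_row3 t x0 y0)).
Qed.

Lemma is_derive_in_t F x y t : smooth_on quadrant F -> 0 < x -> 0 < y ->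
  is_derive t 1 (fun t => F (row3 x y t)) (partial F it (row3 x y t)).
Proof.
move=> Fs x0 y0.
apply: (@is_derive_comp_affine _ _ _ _ (fun t => row3 x y t) F _ _ (delta_mx 0 it)).
  move=> h; apply/rowP => k; rewrite !mxE.
  by case: (ord_xyt k) => -> /=; rewrite ?mulr0 ?mulr1 ?add0r // /GRing.scale /= mulr1.
exact: (smooth_is_derive _ Fs (quadrant_row3 t x0 y0)).
Qed.
End Slices.

(** * Solution of the determining equations in x, y, t *)

Section SolveXYT.
Variables (R : realType) (a b : R).
Hypotheses (ha : a <> 1 / 4) (ha' : a <> 3 / 4) (hb : b <> 0).
Variables (X : 'I_3 -> 'rV[R]_3 -> R) (lam : 'rV[R]_3 -> R).
Hypotheses (X_smooth : forall k, smooth_on quadrant (X k))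
  (lam_smooth : smooth_on quadrant lam).
Hypothesis det : determining_xyt a b (1 / 4) (- b) X lam.

Local Notation D := (@partial R 3).
Local Notation pt := (@row3 R).

Local Notation tau t := (X it (pt 1 1 t)).
Local Notation tau1 t := (D (X it) it (pt 1 1 t)).
Local Notation tau2 t := (D (D (X it) it) it (pt 1 1 t)).
Local Notation tau3 t := (D (D (D (X it) it) it) it (pt 1 1 t)).

(** The point x = y = 1 serves as base point throughout: functions of t alone are named by their
    values there. *)
Lemma tau_of_t x y t : 0 < x -> 0 < y -> X it (pt x y t) = tau t.
Proof.
move=> x0 y0.
rewrite (@derive0_constant_gt0 R (fun x => X it (pt x y t)) _ x 1)//.
  rewrite (@derive0_constant_gt0 R (fun y => X it (pt 1 y t)) _ y 1)// => z z0.
  have [[_ <- _ _ _] _] := det (quadrant_row3 t ltr01 z0).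
  exact: is_derive_in_y.
move=> z z0.
have [[<- _ _ _ _] _] := det (quadrant_row3 t z0 y0).
exact: is_derive_in_x.
Qed.

Lemma tau1_of_t x y t : 0 < x -> 0 < y -> D (X it) it (pt x y t) = tau1 t.
Proof.
move=> x0 y0.
have H : (fun t => X it (pt x y t)) =1 (fun t => tau t).
  by move=> s; exact: tau_of_t.
exact: is_derive_unique H (is_derive_in_t t (X_smooth it) x0 y0)
  (is_derive_in_t t (X_smooth it) ltr01 ltr01).
Qed.

Lemma determining_row3 x y t : 0 < x -> 0 < y ->
  let A := a - b * x in let B := 1 / 4 + b * y in
  let Y := X iy in let X := X ix in let p := pt x y t in
  [/\ x * D Y ix p + y * D X iy p = 0,
      X p - 2 * x * D X ix p + x * tau1 t = 0 &
      Y p - 2 * y * D Y iy p + y * tau1 t = 0] /\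
  [/\ - b * X p + A * (tau1 t - D X ix p) - B * D X iy p - D X it p
        + x * D lam ix p - x / 2 * D (D X ix) ix p - y / 2 * D (D X iy) iy p = 0,
      b * Y p + B * (tau1 t - D Y iy p) - A * D Y ix p - D Y it p
        + y * D lam iy p - x / 2 * D (D Y ix) ix p - y / 2 * D (D Y iy) iy p = 0 &
      D lam it p + A * D lam ix p + B * D lam iy p
        + x / 2 * D (D lam ix) ix p + y / 2 * D (D lam iy) iy p = 0].
Proof.
move=> x0 y0 A B Y X' p.
have BE : B = 1 / 4 - (- b) * y by rewrite /B mulNr opprK.
have [] := det (quadrant_row3 t x0 y0).
rewrite tau1_of_t//= !mxE /= -/A -BE opprK.
by move=> [_ _ e1 e2 e3] [e4 e5 e6]; exact: (conj (And3 e1 e2 e3) (And3 e4 e5 e6)).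
Qed.

Local Notation f y t := (X ix (pt 1 y t) - tau1 t).

Lemma X_profile (p y t : R) : 0 < p -> 0 < y ->
  [/\ X ix (pt (p ^+ 2) y t) = p ^+ 2 * tau1 t + p * f y t,
      D (X ix) ix (pt (p ^+ 2) y t) = tau1 t + f y t / (2 * p) &
      D (D (X ix) ix) ix (pt (p ^+ 2) y t) = - f y t / (4 * p ^+ 3)].
Proof.
move=> p0 y0.
have d1 (x : R) : 0 < x -> is_derive x 1 (fun x => X ix (pt x y t)) (D (X ix) ix (pt x y t)).
  by move=> x0; exact: is_derive_in_x.
have d2 (x : R) : 0 < x -> is_derive x 1 (fun x => D (X ix) ix (pt x y t))
    (D (D (X ix) ix) ix (pt x y t)).
  by move=> x0; apply: is_derive_in_x => //; exact: smooth_partial.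
have E (x : R) : 0 < x -> X ix (pt x y t) - 2 * x * D (X ix) ix (pt x y t) + x * tau1 t = 0.
  by move=> x0; have [[_ e _] _] := determining_row3 t x0 y0.
have [e1 e2] := first_order_in_x_derivatives d1 d2 E p0.
by rewrite (first_order_in_x d1 E p0) e1 e2.
Qed.

Lemma X_profile_y (p y t : R) : 0 < p -> 0 < y ->
  D (X ix) iy (pt (p ^+ 2) y t) = p * D (X ix) iy (pt 1 y t) /\
  D (D (X ix) iy) iy (pt (p ^+ 2) y t) = p * D (D (X ix) iy) iy (pt 1 y t).
Proof.
move=> p0; have p20 : 0 < p ^+ 2 by rewrite exprn_gt0.
have E1 (z : R) : 0 < z -> D (X ix) iy (pt (p ^+ 2) z t) = p * D (X ix) iy (pt 1 z t).
  move=> z0; have H (w : R) : 0 < w ->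
      X ix (pt (p ^+ 2) w t) = (cst (p ^+ 2 * tau1 t) + p \*: (fun w => f w t)) w.
    by move=> w0; have [-> _ _] := X_profile t p0 w0.
  apply: (is_derive_unique_gt0 z0 H (is_derive_in_y t (X_smooth ix) p20 z0)).
  have := is_deriveD (is_derive_cst (p ^+ 2 * tau1 t) z 1) (is_deriveZ p
    (is_deriveB (is_derive_in_y t (X_smooth ix) ltr01 z0) (is_derive_cst (tau1 t) z 1))).
  by move/is_derive_eq; apply; rewrite add0r subr0.
move=> y0; split; first exact: E1.
have Xs : smooth_on quadrant (D (X ix) iy) by exact: smooth_partial.
apply: (is_derive_unique_gt0 y0 E1 (is_derive_in_y t Xs p20 y0)).
exact: is_deriveZ (is_derive_in_y t Xs ltr01 y0).
Qed.

Lemma X_profile_t (p y t : R) : 0 < p -> 0 < y ->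
  D (X ix) it (pt (p ^+ 2) y t) =
    p ^+ 2 * tau2 t + p * (D (X ix) it (pt 1 y t) - tau2 t).
Proof.
move=> p0 y0; have p20 : 0 < p ^+ 2 by rewrite exprn_gt0.
have Ts : smooth_on quadrant (D (X it) it) by exact: smooth_partial.
have dT := is_derive_in_t t Ts ltr01 ltr01.
have H : (fun t => X ix (pt (p ^+ 2) y t)) =1
    p ^+ 2 \*: (fun t => tau1 t) + p \*: ((fun t => X ix (pt 1 y t)) - (fun t => tau1 t)).
  by move=> s; have [-> _ _] := X_profile s p0 y0.
apply: (is_derive_unique H (is_derive_in_t t (X_smooth ix) p20 y0)).
exact: (is_deriveD (is_deriveZ (p ^+ 2) dT)
  (is_deriveZ p (is_deriveB (is_derive_in_t t (X_smooth ix) ltr01 y0) dT))).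
Qed.

Local Notation G y t := (b / 2 * f y t + (1 / 4 + b * y) * D (X ix) iy (pt 1 y t)
  + (D (X ix) it (pt 1 y t) - tau2 t) + y / 2 * D (D (X ix) iy) iy (pt 1 y t)).
Local Notation kappa := (a / 2 - 1 / 8).

(** The coefficient equation of u_x is solved for lambda_x. The most singular term has two sources:
    a X_x contributes a/2 and x/2 X_xx contributes -1/8, which gives [kappa], that is (a - 1/4) /
    2. *)
Lemma lam_x_profile (p y t : R) : 0 < p -> 0 < y ->
  D lam ix (pt (p ^+ 2) y t) =
    b * tau1 t + tau2 t + G y t / p + kappa * f y t / p ^+ 3.
Proof.
move=> p0 y0; have p20 : 0 < p ^+ 2 by rewrite exprn_gt0.
have [_ []] := determining_row3 t p20 y0.
have [-> -> ->] := X_profile t p0 y0; have [-> ->] := X_profile_y t p0 y0.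
rewrite X_profile_t//.
move: (D lam ix _) (D (X ix) iy _) (D (D (X ix) iy) iy _) (D (X ix) it _) (X ix _)
  (tau1 t) (tau2 t) => L Xy Xyy Xt X1 T1 T2 E _ _.
have p2 : p ^+ 2 != 0 by rewrite lt0r_neq0.
apply: (mulfI p2); apply/eqP; rewrite -subr_eq0; apply/eqP; rewrite -[RHS]E.
by field; exact: lt0r_neq0.
Qed.

(* The weights 1, -8, 18, -16, 5 at sqrt x = 1, ..., 5 annihilate the powers
   x^(-1/2), 1, x^(1/2) and x, but not x^(-3/2). *)
Local Notation S5 F := (F 1 - 8 * F 2 + 18 * F 3 - 16 * F 4 + 5 * F 5).

(** [S5] is the fourth finite difference of p F(p) on p = 1, ..., 5, its weights being p times
    alternating binomial coefficients. It therefore kills F = 1/p, 1, p, p^2, for which p F(p) has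
    degree at most 3, and these are the powers of p = sqrt x in lambda. *)
Lemma lam_weights (y t : R) : 0 < y ->
  S5 (fun p : R => lam (pt (p ^+ 2) y t)) = 0.
Proof.
move=> y0.
have dl (x : R) : 0 < x ->
    is_derive x 1 (fun x => lam (pt x y t)) (D lam ix (pt x y t)).
  by move=> x0; exact: is_derive_in_x.
have dE (p : R) (p0 : 0 < p) := lam_x_profile t p0 y0.
have e2 := antiderivative_sqrt dl dE (ltr0n R 2).
have e3 := antiderivative_sqrt dl dE (ltr0n R 3).
have e4 := antiderivative_sqrt dl dE (ltr0n R 4).
have e5 := antiderivative_sqrt dl dE (ltr0n R 5).
rewrite expr1n; move: e2 e3 e4 e5.
move: (lam _) (lam _) (lam _) (lam _) (lam _) (G y t) (f y t) (tau1 t) (tau2 t).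
by move=> *; lra.
Qed.

Lemma is_derive_weights (F : R -> R -> R) (dF : R -> R) (s : R) :
  (forall p, 0 < p -> is_derive s 1 (F p) (dF p)) ->
  is_derive s 1 (fun s => S5 (fun p => F p s)) (S5 dF).
Proof.
move=> Fd.
have d := is_deriveD (is_deriveB (is_deriveD (is_deriveB (Fd 1 ltr01)
  (is_deriveZ 8 (Fd 2 (ltr0n R 2)))) (is_deriveZ 18 (Fd 3 (ltr0n R 3))))
  (is_deriveZ 16 (Fd 4 (ltr0n R 4)))) (is_deriveZ 5 (Fd 5 (ltr0n R 5))).
exact: d.
Qed.

(** The weighted sum of lambda vanishes identically in y and t, so it can be differentiated without
    knowing the derivatives of the individual coefficients. *)
Lemma lam_derivative_weights (y t : R) : 0 < y ->
  [/\ S5 (fun p : R => D lam it (pt (p ^+ 2) y t)) = 0,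
      S5 (fun p : R => D lam iy (pt (p ^+ 2) y t)) = 0 &
      S5 (fun p : R => D (D lam iy) iy (pt (p ^+ 2) y t)) = 0].
Proof.
have p20 (p : R) : 0 < p -> 0 < p ^+ 2 by move=> p0; rewrite exprn_gt0.
have Ey (z : R) : 0 < z -> S5 (fun p : R => D lam iy (pt (p ^+ 2) z t)) = 0.
  move=> z0.
  have Fd (p : R) : 0 < p ->
      is_derive z 1 (fun z => lam (pt (p ^+ 2) z t)) (D lam iy (pt (p ^+ 2) z t)).
    by move=> p0; exact: (is_derive_in_y t lam_smooth (p20 _ p0) z0).
  have W (w : R) : 0 < w -> S5 (fun p : R => lam (pt (p ^+ 2) w t)) = cst 0 w.
    exact: lam_weights.
  exact: (is_derive_unique_gt0 z0 W (is_derive_weights Fd) (is_derive_cst 0 z 1)).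
move=> y0; split; last 2 first.
- exact: Ey.
- have Fd (p : R) : 0 < p -> is_derive y 1 (fun z => D lam iy (pt (p ^+ 2) z t))
      (D (D lam iy) iy (pt (p ^+ 2) y t)).
    move=> p0; apply: (is_derive_in_y t _ (p20 _ p0) y0); exact: smooth_partial.
  exact: (is_derive_unique_gt0 y0 Ey (is_derive_weights Fd) (is_derive_cst 0 y 1)).
- have Fd (p : R) : 0 < p ->
      is_derive t 1 (fun s => lam (pt (p ^+ 2) y s)) (D lam it (pt (p ^+ 2) y t)).
    by move=> p0; exact: (is_derive_in_t t lam_smooth (p20 _ p0) y0).
  have W (s : R) : S5 (fun p : R => lam (pt (p ^+ 2) y s)) = cst 0 s.
    exact: lam_weights.
  exact: (is_derive_unique W (is_derive_weights Fd) (is_derive_cst 0 t 1)).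
Qed.

(** Apply the weights to the last determining equation. The t- and y-derivatives of lambda drop out,
    and so do all powers of p except p^(-3). That power comes from a lambda_x and x/2 lambda_xx,
    with total coefficient kappa (a - 3/4) f. *)
Lemma f_eq0 (y t : R) : 0 < y -> f y t = 0.
Proof.
move=> y0; have [wt wy wyy] := lam_derivative_weights t y0.
have p20 (p : R) : 0 < p -> 0 < p ^+ 2 by move=> p0; rewrite exprn_gt0.
have dlx (x : R) : 0 < x ->
    is_derive x 1 (fun x => D lam ix (pt x y t)) (D (D lam ix) ix (pt x y t)).
  by move=> x0; apply: is_derive_in_x => //; exact: smooth_partial.
have lxE (p : R) (p0 : 0 < p) := lam_x_profile t p0 y0.
have E (p : R) : 0 < p ->
    D lam it (pt (p ^+ 2) y t) + (a - b * p ^+ 2) *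
      (b * tau1 t + tau2 t + G y t / p + kappa * f y t / p ^+ 3)
    + (1 / 4 + b * y) * D lam iy (pt (p ^+ 2) y t) + p ^+ 2 / 2 *
      (- G y t / (2 * p ^+ 3) - 3 * (kappa * f y t) / (2 * p ^+ 5))
    + y / 2 * D (D lam iy) iy (pt (p ^+ 2) y t) = 0.
  move=> p0; have [_ [_ _ e]] := determining_row3 t (p20 _ p0) y0.
  by rewrite -(lxE p p0) -(derivative_sqrt dlx lxE p0).
have e1 := E 1 ltr01; have e2 := E 2 (ltr0n R 2); have e3 := E 3 (ltr0n R 3).
have e4 := E 4 (ltr0n R 4); have e5 := E 5 (ltr0n R 5).
have {}wy := congr1 ( *%R (1 / 4 + b * y)) wy.
have {}wyy := congr1 ( *%R (y / 2)) wyy.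
have : (a - 1 / 4) * (a - 3 / 4) * f y t = 0.
  move: wt wy wyy e1 e2 e3 e4 e5; move: {E lxE dlx} (f y t) (G y t).
  move: (tau1 t) (tau2 t) (1 / 4 + b * y) (y / 2) => t1 t2 B y2 h g.
  do 5!move: (D lam it _) => ?; do 5!move: (D lam iy _) => ?.
  do 5!move: (D (D lam iy) iy _) => ?.
  by move=> *; lra.
move/eqP; rewrite !mulf_eq0 !subr_eq0 => /orP[/orP[]|] /eqP.
- by move/ha.
- by move/ha'.
- by move=> ->; rewrite subrr.
Qed.

Lemma row3_eta (p : 'rV[R]_3) : p = pt (p 0 ix) (p 0 iy) (p 0 it).
Proof. by apply/rowP => k; rewrite mxE; case: (ord_xyt k) => ->. Qed.

Lemma X_eq (x y t : R) : 0 < x -> 0 < y -> X ix (pt x y t) = x * tau1 t.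
Proof.
move=> x0 y0; have s0 : 0 < Num.sqrt x by rewrite sqrtr_gt0.
have [] := X_profile t s0 y0; rewrite (f_eq0 t y0) sqr_sqrtr ?ltW// => -> _ _.
by rewrite mulr0 addr0.
Qed.

Lemma X_y_eq0 (x y t : R) : 0 < x -> 0 < y -> D (X ix) iy (pt x y t) = 0.
Proof.
move=> x0 y0.
have H (z : R) : 0 < z -> X ix (pt x z t) = cst (x * tau1 t) z by exact: X_eq.
exact: (is_derive_unique_gt0 y0 H (is_derive_in_y t (X_smooth ix) x0 y0)
  (is_derive_cst _ y 1)).
Qed.

(** G is a combination of f, its y-derivatives and its t-derivative, all of which now vanish: at x =
    1, X is tau1 for every y and t. *)
Lemma G_eq0 (y t : R) : 0 < y -> G y t = 0.
Proof.
move=> y0; rewrite f_eq0// (X_y_eq0 t ltr01 y0).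
have -> : D (D (X ix) iy) iy (pt 1 y t) = 0.
  apply: (@partial_eq0 _ _ _ (@open_quadrant R)); first exact: quadrant_row3.
  by move=> q [qx qy]; rewrite (row3_eta q) X_y_eq0.
have Ts : smooth_on quadrant (D (X it) it) by exact: smooth_partial.
have H (s : R) : X ix (pt 1 y s) = tau1 s by rewrite X_eq// mul1r.
rewrite (is_derive_unique H (is_derive_in_t t (X_smooth ix) ltr01 y0)
  (is_derive_in_t t Ts ltr01 ltr01)).
by rewrite subrr !mulr0 !addr0.
Qed.

Lemma Y_x_eq0 q : quadrant q -> D (X iy) ix q = 0.
Proof.
move=> [x0 y0]; rewrite (row3_eta q).
have [[e _ _] _] := determining_row3 (q 0 it) x0 y0.
move: e; rewrite X_y_eq0// mulr0 addr0 => /eqP.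
by rewrite mulf_eq0 (gt_eqF x0) => /eqP.
Qed.

Lemma Y_of_yt (x y t : R) : 0 < x -> 0 < y -> X iy (pt x y t) = X iy (pt 1 y t).
Proof.
move=> x0 y0.
apply: (@derive0_constant_gt0 R (fun x => X iy (pt x y t))) => // z z0.
rewrite -(Y_x_eq0 (quadrant_row3 t z0 y0)); exact: is_derive_in_x.
Qed.

Local Notation g t := (X iy (pt 1 1 t) - tau1 t).
Local Notation g1 t := (D (X iy) it (pt 1 1 t) - tau2 t).
Local Notation g2 t := (D (D (X iy) it) it (pt 1 1 t) - tau3 t).

Lemma Y_profile (x q t : R) : 0 < x -> 0 < q ->
  [/\ X iy (pt x (q ^+ 2) t) = q ^+ 2 * tau1 t + q * g t,
      D (X iy) iy (pt x (q ^+ 2) t) = tau1 t + g t / (2 * q),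
      D (D (X iy) iy) iy (pt x (q ^+ 2) t) = - g t / (4 * q ^+ 3) &
      D (X iy) it (pt x (q ^+ 2) t) = q ^+ 2 * tau2 t + q * g1 t].
Proof.
move=> x0 q0; have q20 : 0 < q ^+ 2 by rewrite exprn_gt0.
have d1 (y : R) : 0 < y ->
    is_derive y 1 (fun y => X iy (pt x y t)) (D (X iy) iy (pt x y t)).
  by move=> y0; exact: is_derive_in_y.
have d2 (y : R) : 0 < y -> is_derive y 1 (fun y => D (X iy) iy (pt x y t))
    (D (D (X iy) iy) iy (pt x y t)).
  by move=> y0; apply: is_derive_in_y => //; exact: smooth_partial.
have E s (y : R) : 0 < y ->
    X iy (pt x y s) - 2 * y * D (X iy) iy (pt x y s) + y * tau1 s = 0.
  by move=> y0; have [[_ _ e] _] := determining_row3 s x0 y0.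
have [e1 e2] := first_order_in_x_derivatives d1 d2 (E t) q0.
rewrite e1 e2 (Y_of_yt t x0 ltr01).
have YE s : X iy (pt x (q ^+ 2) s) = q ^+ 2 * tau1 s + q * g s.
  rewrite -(Y_of_yt s x0 ltr01).
  apply: (first_order_in_x (fun y (y0 : 0 < y) => is_derive_in_y s (X_smooth iy) x0 y0)) => //.
  exact: E.
rewrite YE; split => //.
have Ts : smooth_on quadrant (D (X it) it) by exact: smooth_partial.
have dT := is_derive_in_t t Ts ltr01 ltr01.
exact: (is_derive_unique YE (is_derive_in_t t (X_smooth iy) x0 q20)
  (is_deriveD (is_deriveZ (q ^+ 2) dT)
  (is_deriveZ q (is_deriveB (is_derive_in_t t (X_smooth iy) ltr01 ltr01) dT)))).
Qed.

Local Notation G2 t := (g1 t - b / 2 * g t).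

Lemma lam_x_eq (x y t : R) : 0 < x -> 0 < y ->
  D lam ix (pt x y t) = b * tau1 t + tau2 t.
Proof.
move=> x0 y0; have s0 : 0 < Num.sqrt x by rewrite sqrtr_gt0.
have := lam_x_profile t s0 y0.
by rewrite G_eq0// f_eq0// sqr_sqrtr ?ltW// mulr0 !mul0r !addr0.
Qed.

(** The analogue of [kappa] is d/2 - 1/8, which is 0 for d = 1/4; this is why g, unlike f, is not
    forced to vanish. The zero term keeps the shape expected by [antiderivative_sqrt]. *)
Lemma lam_y_profile (x q t : R) : 0 < x -> 0 < q ->
  D lam iy (pt x (q ^+ 2) t) = tau2 t - b * tau1 t + G2 t / q + 0 / q ^+ 3.
Proof.
move=> x0 q0; have q20 : 0 < q ^+ 2 by rewrite exprn_gt0.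
have [_ [_ e _]] := determining_row3 t x0 q20.
have Yxx : D (D (X iy) ix) ix (pt x (q ^+ 2) t) = 0.
  apply: (@partial_eq0 _ _ _ (@open_quadrant R)); first exact: quadrant_row3.
  exact: Y_x_eq0.
move: e; have [-> -> -> ->] := Y_profile t x0 q0.
rewrite Yxx (Y_x_eq0 (quadrant_row3 t x0 q20)).
move: (D lam iy _) (D (X iy) it _) (X iy _) (tau1 t) (tau2 t) => L Yt Y1 T1 T2 E.
have q2 : q ^+ 2 != 0 by rewrite lt0r_neq0.
apply: (mulfI q2); apply/eqP; rewrite -subr_eq0; apply/eqP; rewrite -[RHS]E.
by field; exact: lt0r_neq0.
Qed.

(** Integrate lambda_x from 1 to p^2 at height y = q^2, then lambda_y from 1 to q^2 along x = 1. *)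
Lemma lam_formula (p q t : R) : 0 < p -> 0 < q ->
  lam (pt (p ^+ 2) (q ^+ 2) t) = (b * tau1 t + tau2 t) * (p ^+ 2 - 1)
    + (tau2 t - b * tau1 t) * (q ^+ 2 - 1) + 2 * G2 t * (q - 1) + lam (pt 1 1 t).
Proof.
move=> p0 q0; have q20 : 0 < q ^+ 2 by rewrite exprn_gt0.
have dx (x : R) (x0 : 0 < x) := is_derive_in_x t lam_smooth x0 q20.
have dy (y : R) (y0 : 0 < y) := is_derive_in_y t lam_smooth ltr01 y0.
have ex (r : R) : 0 < r -> D lam ix (pt (r ^+ 2) (q ^+ 2) t) =
    b * tau1 t + tau2 t + 0 / r + 0 / r ^+ 3.
  by move=> r0; rewrite lam_x_eq ?exprn_gt0// !mul0r !addr0.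
have e1 := antiderivative_sqrt dx ex p0.
have e2 := antiderivative_sqrt dy (fun q q0 => lam_y_profile t ltr01 q0) q0.
move: e1 e2; move: (lam _) (lam _) (lam _) (G2 t) (tau1 t) (tau2 t) => *; lra.
Qed.

Lemma lam_t_formula (p q t : R) : 0 < p -> 0 < q ->
  D lam it (pt (p ^+ 2) (q ^+ 2) t) = (b * tau2 t + tau3 t) * (p ^+ 2 - 1)
    + (tau3 t - b * tau2 t) * (q ^+ 2 - 1) + 2 * (g2 t - b / 2 * g1 t) * (q - 1)
    + D lam it (pt 1 1 t).
Proof.
move=> p0 q0; have p20 : 0 < p ^+ 2 by rewrite exprn_gt0.
have q20 : 0 < q ^+ 2 by rewrite exprn_gt0.
have Ts : smooth_on quadrant (D (X it) it) by exact: smooth_partial.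
have Tss : smooth_on quadrant (D (D (X it) it) it) by exact: smooth_partial.
have Ys : smooth_on quadrant (D (X iy) it) by exact: smooth_partial.
have dT := is_derive_in_t t Ts ltr01 ltr01.
have dTt := is_derive_in_t t Tss ltr01 ltr01.
have dg := is_deriveB (is_derive_in_t t (X_smooth iy) ltr01 ltr01) dT.
have dg1 := is_deriveB (is_derive_in_t t Ys ltr01 ltr01) dTt.
have d := is_deriveD (is_deriveD (is_deriveD
  (is_deriveZ (p ^+ 2 - 1) (is_deriveD (is_deriveZ b dT) dTt))
  (is_deriveZ (q ^+ 2 - 1) (is_deriveB dTt (is_deriveZ b dT))))
  (is_deriveZ (2 * (q - 1)) (is_deriveB dg1 (is_deriveZ (b / 2) dg))))
  (is_derive_in_t t lam_smooth ltr01 ltr01).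
have H (s : R) := lam_formula s p0 q0.
rewrite (is_derive_unique _ (is_derive_in_t t lam_smooth p20 q20) d).
  rewrite /GRing.scale /= /GRing.scale /=.
  move: (D lam it _) (D (D (X iy) it) it _) (tau3 t) (D (X iy) it _)
    (tau2 t) => *.
  by ring.
move=> s; rewrite H !fctE /GRing.scale /= /GRing.scale /=.
move: (lam _) (D (X iy) it _) (X iy _) (tau2 s) (tau1 s) => *.
by ring.
Qed.

(** After substitution the last determining equation reads alpha (p^2 + q^2) + beta q + gamma = 0:
    the coefficients of p^2 and q^2 coincide because e = - b, and the terms in 1/q cancel because d
    = 1/4. Three sample points thus separate the three equations. *)
Lemma reduced_odes t :
  [/\ tau3 t = b ^+ 2 * tau1 t, g2 t = b ^+ 2 / 4 * g t &
      D lam it (pt 1 1 t) = 2 * tau3 t + 2 * (g2 t - b / 2 * g1 t)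
        - a * (b * tau1 t + tau2 t) - 1 / 4 * (tau2 t - b * tau1 t)].
Proof.
have E (p q : R) : 0 < p -> 0 < q -> (b * tau2 t + tau3 t) * (p ^+ 2 - 1)
    + (tau3 t - b * tau2 t) * (q ^+ 2 - 1) + 2 * (g2 t - b / 2 * g1 t) * (q - 1)
    + D lam it (pt 1 1 t) + (a - b * p ^+ 2) * (b * tau1 t + tau2 t)
    + (1 / 4 + b * q ^+ 2) * (tau2 t - b * tau1 t + G2 t / q + 0 / q ^+ 3)
    + q ^+ 2 / 2 * (- G2 t / (2 * q ^+ 3) - 3 * 0 / (2 * q ^+ 5)) = 0.
  move=> p0 q0; have p20 : 0 < p ^+ 2 by rewrite exprn_gt0.
  have q20 : 0 < q ^+ 2 by rewrite exprn_gt0.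
  have [_ [_ _]] := determining_row3 t p20 q20.
  rewrite lam_t_formula// lam_x_eq// lam_y_profile//.
  have -> : D (D lam ix) ix (pt (p ^+ 2) (q ^+ 2) t) = 0.
    have H (x : R) : 0 < x -> D lam ix (pt x (q ^+ 2) t) = cst (b * tau1 t + tau2 t) x.
      by move=> x0; exact: lam_x_eq.
    apply: (is_derive_unique_gt0 p20 H _ (is_derive_cst _ _ _)).
    by apply: is_derive_in_x => //; exact: smooth_partial.
  have dy (y : R) : 0 < y -> is_derive y 1 (fun y => D lam iy (pt (p ^+ 2) y t))
      (D (D lam iy) iy (pt (p ^+ 2) y t)).
    by move=> y0; apply: is_derive_in_y => //; exact: smooth_partial.
  rewrite (derivative_sqrt dy (fun q q0 => lam_y_profile t p20 q0) q0).
  by rewrite mulr0 addr0.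
have e1 := E 1 1 ltr01 ltr01; have e2 := E 2 1 (ltr0n R 2) ltr01.
have e3 := E 1 2 ltr01 (ltr0n R 2).
move: e1 e2 e3 => {E}.
move: (D lam it _) (D (D (X iy) it) it _) (tau3 t) (D (X iy) it _) (X iy _)
  (tau2 t) (tau1 t) => l y2 t3 y1 y0 t2 t1 e1 e2 e3.
have E1 : t3 = b ^+ 2 * t1 by lra.
by split; lra.
Qed.
End SolveXYT.

(** * Integration of the reduced equations into a six-parameter family *)

Section SolutionXYT.
Variables (R : realType) (a b : R).

Definition coord6 (w : 'rV[R]_6) k := w 0 (inord k).

(* The field attached to w0 E + w1 F + w2 H + w3 X + w4 Y + w5 Z, where
   E = v1 / b, F = - v2 / b, H = 2 v3 / b, X = v5, Y = - v4 and Z = b v6. *)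
Definition xi_xyt (w : 'rV[R]_6) (k : 'I_3) : expr R 'I_3 :=
  let c := coord6 w in
  let dtau := ((c 0%N)%:C * Exp b it + (c 1%N)%:C * Exp (- b) it)%X in
  let s := (Crd iy * RSqrt iy)%X in
  nth (Cst 0) [::
    (Crd ix * dtau)%X;
    (Crd iy * dtau + s * ((c 3%N)%:C * Exp (b / 2) it
                          + (- c 4%N)%:C * Exp (- (b / 2)) it))%X;
    ((c 0%N / b)%:C * Exp b it + (- c 1%N / b)%:C * Exp (- b) it
       + (2 * c 2%N / b)%:C)%X] k.

Definition lam_xyt (w : 'rV[R]_6) : expr R 'I_3 :=
  let c := coord6 w in
  let s := (Crd iy * RSqrt iy)%X in
  (((2 * b * c 0%N)%:C * Crd ix + (- 2 * a * c 0%N)%:C) * Exp b it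
    + ((- 2 * b * c 1%N)%:C * Crd iy + (- c 1%N / 2)%:C) * Exp (- b) it
    + (c 2%N * (1 / 2 - 2 * a))%:C
    + (2 * b * c 4%N)%:C * (s * Exp (- (b / 2)) it)
    + (b * c 5%N)%:C)%X.

Hypotheses (ha : a <> 1 / 4) (ha' : a <> 3 / 4) (hb : b <> 0).
Variables (X : 'I_3 -> 'rV[R]_3 -> R) (lam : 'rV[R]_3 -> R).
Hypotheses (X_smooth : forall k, smooth_on quadrant (X k))
  (lam_smooth : smooth_on quadrant lam).
Hypothesis det : determining_xyt a b (1 / 4) (- b) X lam.

Local Notation D := (@partial R 3).
Local Notation pt := (@row3 R).
Local Notation tau t := (X it (pt 1 1 t)).
Local Notation tau1 t := (D (X it) it (pt 1 1 t)).
Local Notation tau2 t := (D (D (X it) it) it (pt 1 1 t)).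
Local Notation tau3 t := (D (D (D (X it) it) it) it (pt 1 1 t)).
Local Notation g t := (X iy (pt 1 1 t) - tau1 t).
Local Notation g1 t := (D (X iy) it (pt 1 1 t) - tau2 t).
Local Notation g2 t := (D (D (X iy) it) it (pt 1 1 t) - tau3 t).

Lemma determining_xyt_solution : exists w : 'rV[R]_6, forall p, quadrant p ->
  (forall k, X k p = eval (p 0) (xi_xyt w k)) /\ lam p = eval (p 0) (lam_xyt w).
Proof.
have bn0 : b != 0 by apply/eqP.
have dt0 t := is_derive_in_t t (X_smooth it) ltr01 ltr01.
have dt1 t := is_derive_in_t t (smooth_partial it (X_smooth it)) ltr01 ltr01.
have dt2 t := is_derive_in_t t
  (smooth_partial it (smooth_partial it (X_smooth it))) ltr01 ltr01.
have dy0 t := is_derive_in_t t (X_smooth iy) ltr01 ltr01.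
have dy1 t := is_derive_in_t t (smooth_partial it (X_smooth iy)) ltr01 ltr01.
have dl t := is_derive_in_t t lam_smooth ltr01 ltr01.
have odes := reduced_odes ha ha' X_smooth lam_smooth det.
(* The equation T''' = b^2 T' is split into first order ones: T'' + b T' and T'' - b T' have
   logarithmic rates b and - b. The function g is treated in the same way with b/2. *)
have up t : tau2 t + b * tau1 t = (tau2 0 + b * tau1 0) * expR (b * t).
  apply: (@linear_ode R (fun t => tau2 t + b * tau1 t)) => {}t.
  apply: is_derive_eq (is_deriveD (dt2 t) (is_deriveZ b (dt1 t))) _.
  by have [-> _ _] := odes t; rewrite /GRing.scale /=; ring.
have um t : tau2 t - b * tau1 t = (tau2 0 - b * tau1 0) * expR (- b * t).
  apply: (@linear_ode R (fun t => tau2 t - b * tau1 t)) => {}t.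
  apply: is_derive_eq (is_deriveB (dt2 t) (is_deriveZ b (dt1 t))) _.
  by have [-> _ _] := odes t; rewrite /GRing.scale /=; ring.
have dg t := is_deriveB (dy0 t) (dt1 t).
have dg1 t := is_deriveB (dy1 t) (dt2 t).
have hp t : g1 t + b / 2 * g t = (g1 0 + b / 2 * g 0) * expR (b / 2 * t).
  apply: (@linear_ode R (fun t => g1 t + b / 2 * g t)) => {}t.
  apply: is_derive_eq (is_deriveD (dg1 t) (is_deriveZ (b / 2) (dg t))) _.
  have [_ e _] := odes t; move: e; rewrite /GRing.scale /=.
  move: (D (D (X iy) it) it _) (tau3 t) (D (X iy) it _) (tau2 t) (X iy _) (tau1 t).
  by move=> y2 t3 y1 t2 y0 t1 ->; field.
have hm t : g1 t - b / 2 * g t = (g1 0 - b / 2 * g 0) * expR (- (b / 2) * t).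
  apply: (@linear_ode R (fun t => g1 t - b / 2 * g t)) => {}t.
  apply: is_derive_eq (is_deriveB (dg1 t) (is_deriveZ (b / 2) (dg t))) _.
  have [_ e _] := odes t; move: e; rewrite /GRing.scale /=.
  move: (D (D (X iy) it) it _) (tau3 t) (D (X iy) it _) (tau2 t) (X iy _) (tau1 t).
  by move=> y2 t3 y1 t2 y0 t1 ->; field.
have ct t : b ^+ 2 * tau t - tau2 t = b ^+ 2 * tau 0 - tau2 0.
  apply: (@derive0_constant R (fun t => b ^+ 2 * tau t - tau2 t)) => {}t.
  apply: is_derive_eq (is_deriveB (is_deriveZ (b ^+ 2) (dt0 t)) (dt2 t)) _.
  by have [-> _ _] := odes t; rewrite /GRing.scale /=; ring.
(* The first order equation for lambda at x = y = 1 has a total derivative as right hand side; k is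
   lambda minus its primitive, hence a constant of integration. *)
pose k t := lam (pt 1 1 t) - 2 * tau2 t
  - 2 * (g1 t - b / 2 * g t) + a * (b * tau t + tau1 t)
  + 1 / 4 * (tau1 t - b * tau t).
have kt t : k t = k 0.
  apply: derive0_constant => {}t.
  apply: is_derive_eq (is_deriveD (is_deriveD (is_deriveB (is_deriveB (dl t)
    (is_deriveZ 2 (dt2 t)))
    (is_deriveZ 2 (is_deriveB (dg1 t) (is_deriveZ (b / 2) (dg t)))))
    (is_deriveZ a (is_deriveD (is_deriveZ b (dt0 t)) (dt1 t))))
    (is_deriveZ (1 / 4) (is_deriveB (dt1 t) (is_deriveZ b (dt0 t))))) _.
  have [_ _ ->] := odes t; rewrite /GRing.scale /= /GRing.scale /=.
  move: (D (D (X iy) it) it _) (tau3 t) (D (X iy) it _) (tau2 t) (tau1 t) => *.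
  by field.
(* The six constants of integration, taken at t = 0 and scaled to be the coordinates used by
   [xi_xyt] and [lam_xyt]. *)
pose w : 'rV[R]_6 := \row_i nth 0 [::
  (tau2 0 + b * tau1 0) / (2 * b); - (tau2 0 - b * tau1 0) / (2 * b);
  (b ^+ 2 * tau 0 - tau2 0) / (2 * b);
  (g1 0 + b / 2 * g 0) / b; (g1 0 - b / 2 * g 0) / b; k 0 / b] i.
exists w => p [].
rewrite (row3_eta p); move: (p 0 ix) (p 0 iy) (p 0 it) => x y t.
rewrite !mxE /= => x0 y0.
have wE j : (j < 6)%N -> coord6 w j = nth 0 [::
  (tau2 0 + b * tau1 0) / (2 * b); - (tau2 0 - b * tau1 0) / (2 * b);
  (b ^+ 2 * tau 0 - tau2 0) / (2 * b);
  (g1 0 + b / 2 * g 0) / b; (g1 0 - b / 2 * g 0) / b; k 0 / b] j.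
  by move=> j6; rewrite /coord6 mxE inordK.
have XE := X_eq ha ha' X_smooth lam_smooth det.
have YE := Y_profile ha ha' X_smooth lam_smooth det.
have LE := lam_formula ha ha' X_smooth lam_smooth det.
have TE := tau_of_t X_smooth det.
have t1E : tau1 t = ((tau2 0 + b * tau1 0) * expR (b * t) -
    (tau2 0 - b * tau1 0) * expR (- b * t)) / (2 * b).
  by rewrite -up -um; field.
have t2E : tau2 t = ((tau2 0 + b * tau1 0) * expR (b * t) +
    (tau2 0 - b * tau1 0) * expR (- b * t)) / 2.
  by rewrite -up -um; field.
have tE : tau t = (tau2 t + (b ^+ 2 * tau 0 - tau2 0)) / b ^+ 2.
  by rewrite -(ct t); field.
have gE : g t = ((g1 0 + b / 2 * g 0) * expR (b / 2 * t) -
    (g1 0 - b / 2 * g 0) * expR (- (b / 2) * t)) / b.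
  by rewrite -hp -hm; field.
have lE : lam (pt 1 1 t) = k 0 + 2 * tau2 t + 2 * (g1 t - b / 2 * g t)
    - a * (b * tau t + tau1 t) - 1 / 4 * (tau1 t - b * tau t).
  by rewrite -(kt t) /k; ring.
move: up um hp hm ct => _ _ _ hm _.
have sq (z : R) : 0 < z ->
    exists q, [/\ 0 < q, z = q ^+ 2 & Num.sqrt (q ^+ 2) = q].
  move=> z0; exists (Num.sqrt z).
  by rewrite sqrtr_gt0 z0 sqr_sqrtr ?ltW.
have [q [q0 yE sqE]] := sq y y0; have [r [r0 xE _]] := sq x x0.
move: x0 y0; rewrite {}xE {}yE => x0 y0.
split.
  move=> i; case: (ord_xyt i) => -> /=; rewrite !mxE /= ?wE//=.
  - rewrite XE// t1E; move: (expR _) (expR _) => *; field; exact: bn0.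
  - have [-> _ _ _] := YE (r ^+ 2) q t x0 q0.
    rewrite gE t1E sqE.
    move: (expR _) (expR _) (expR _) (expR _) => *.
    by field; rewrite bn0 lt0r_neq0.
  - rewrite TE// tE t2E; move: (expR _) (expR _) => *; field; exact: bn0.
rewrite /= !mxE /= !wE//= sqE LE// lE hm tE t2E t1E.
move: (k 0) (expR _) (expR _) (expR _) => *.
by field; rewrite bn0 lt0r_neq0.
Qed.
End SolutionXYT.

(** * Smoothness, derivatives and brackets of fields given by expressions *)

Fixpoint map_expr (R I J : Type) (h : I -> J) (e : expr R I) : expr R J :=
  match e with
  | Cst c => Cst c
  | Crd i => Crd (h i)
  | Add e f => Add (map_expr h e) (map_expr h f)
  | Mul e f => Mul (map_expr h e) (map_expr h f)
  | Exp c i => Exp c (h i)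
  | RSqrt i => RSqrt (h i)
  end.

Lemma eval_map_expr (R : realType) (I J : Type) (h : I -> J) (e : expr R I) p :
  eval p (map_expr h e) = eval (p \o h) e.
Proof. by elim: e => //= e -> f ->. Qed.

Lemma diff_map_expr (R : realType) (I J : Type) (h : I -> J) (e : expr R I) v :
  diff v (map_expr h e) = map_expr h (diff (v \o h) e).
Proof. by elim: e => //= e -> f ->. Qed.

Lemma wf_map_expr (R : realType) (I J : Type) (h : I -> J) (e : expr R I) pos :
  wf pos (map_expr h e) = wf (pos \o h) e.
Proof. by elim: e => //= e -> f ->. Qed.

Section ExplicitFields.
Variables (R : realType) (n : nat) (Om : set 'rV[R]_n) (pos : pred 'I_n).
Hypothesis openOm : open Om.
Hypothesis Om_pos : forall i (p : 'rV[R]_n), pos i -> Om p -> 0 < p 0 i.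

Lemma coord_linear i (h : R) (v p : 'rV[R]_n) :
  (h *: v + p) 0 i = h * v 0 i + p 0 i.
Proof. by rewrite !mxE. Qed.

Lemma is_derive_eval_row (e : expr R 'I_n) (p v : 'rV[R]_n) : Om p -> wf pos e ->
  is_derive p v (fun q : 'rV[R]_n => eval (q 0) e) (eval (p 0) (diff (v 0) e)).
Proof.
exact: (@is_derive_eval R _ _ (fun i (p : 'rV[R]_n) => p 0 i) Om pos coord_linear Om_pos).
Qed.

Lemma smooth_eval (e : expr R 'I_n) : wf pos e ->
  smooth_on Om (fun p : 'rV[R]_n => eval (p 0) e).
Proof.
move=> we k.
have := @smooth_eval_sum R _ _ (fun i (p : 'rV[R]_n) => p 0 i) Om pos coord_linear
  (fun i => @coord_continuous R 1 n 0 i) Om_pos openOm R 1 (fun=> e) (fun=> 1) (fun=> we) k.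
apply: eq_on_open_Ck => // p _.
by rewrite big_ord1 /GRing.scale /= mulr1.
Qed.

Definition unit_vector (i : 'I_n) (l : 'I_n) : R := (l == i)%:R.

Lemma eq_diff (e : expr R 'I_n) v w : v =1 w -> diff v e = diff w e.
Proof. by move=> vw; elim: e => //= [i|e -> f ->|e -> f ->|c i|i] //; rewrite vw. Qed.

Lemma partial_eval (e : expr R 'I_n) i p : Om p -> wf pos e ->
  partial (fun p : 'rV[R]_n => eval (p 0) e) i p =
  eval (p 0) (diff (unit_vector i) e).
Proof.
move=> Omp we; have [_ E] := is_derive_eval_row (delta_mx 0 i) Omp we.
apply: etrans E _; congr eval; apply: eq_diff => l.
by rewrite mxE.
Qed.

Lemma partial2_eval (e : expr R 'I_n) i l p : Om p -> wf pos e ->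
  partial (partial (fun p : 'rV[R]_n => eval (p 0) e) i) l p =
  eval (p 0) (diff (unit_vector l) (diff (unit_vector i) e)).
Proof.
move=> Omp we; rewrite -partial_eval ?wf_diff//.
apply: (eq_on_open_partial openOm) => // q Omq.
exact: partial_eval.
Qed.

Definition explicit_field (xi : 'I_n -> expr R 'I_n) (lam : expr R 'I_n) : field R n :=
  ext0 Om (fun z => (\row_k eval (z.1 0) (xi k), eval (z.1 0) lam * z.2)).

Section OneField.
Variables (xi : 'I_n -> expr R 'I_n) (lam : expr R 'I_n).
Hypotheses (wf_xi : forall k, wf pos (xi k)) (wf_lam : wf pos lam).

Local Notation V := (explicit_field xi lam).

Lemma explicit_fieldE z : over Om z ->
  V z = (\row_k eval (z.1 0) (xi k), eval (z.1 0) lam * z.2).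
Proof. by move=> Omz; rewrite /explicit_field /ext0 /patch mem_set. Qed.

Lemma explicit_field_out z : ~ over Om z -> V z = 0.
Proof. by move=> Omz; rewrite /explicit_field /ext0 /patch memNset. Qed.

(** The coordinates of the space of (x, u) are indexed by an option type, [None] being u. Likewise,
    among the n + 1 components of a field, index 0 is the u-component, and [unlift] recovers the
    others. *)
Let crd (i : option 'I_n) (z : jet0 R n) := if i is Some i then z.1 0 i else z.2.
Let fields (i : 'I_n.+1) : expr R (option 'I_n) :=
  if unlift ord0 i is Some k then map_expr Some (xi k)
  else Mul (map_expr Some lam) (Crd None).
Let directions (i : 'I_n.+1) : jet0 R n :=
  if unlift ord0 i is Some k then (delta_mx 0 k, 0) else (0, 1).
Let pos' (i : option 'I_n) := if i is Some i then pos i else false.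

Let crd_linear i (h : R) v p : crd i (h *: v + p) = h * crd i v + crd i p.
Proof. by case: i => [i|] //=; rewrite !mxE. Qed.

Let crd_continuous i : continuous (crd i).
Proof.
case: i => [i|] z /=; last exact: cvg_snd.
apply: (@continuous_comp _ _ _ fst (fun p : 'rV[R]_n => p 0 i)); first exact: cvg_fst.
exact: coord_continuous.
Qed.

Let crd_pos i p : pos' i -> over Om p -> 0 < crd i p.
Proof. by case: i => //= i posi Omp; exact: Om_pos. Qed.

Let wf_fields i : wf pos' (fields i).
Proof. by rewrite /fields; case: unlift => [k|] /=; rewrite ?andbT wf_map_expr. Qed.

Let sum_fields (F : expr R (option 'I_n) -> R) :
  \sum_(i < n.+1) F (fields i) *: directions i =
  (\row_k F (map_expr Some (xi k)), F (Mul (map_expr Some lam) (Crd None))).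
Proof.
rewrite big_ord_recl /fields /directions unlift_none.
under eq_bigr => i _ do rewrite liftK.
rewrite [RHS]surjective_pairing [LHS]surjective_pairing /=.
have pair_sum (G : 'I_n -> jet0 R n) :
    \sum_i G i = (\sum_i (G i).1, \sum_i (G i).2).
  by elim/big_rec3: _ => //= i x y z _ ->.
rewrite pair_sum /= scaler0 add0r; congr (_, _).
  apply/rowP => k; rewrite summxE mxE (bigD1 k)//= big1 => [|i /negPf ik].
    by rewrite !mxE !eqxx mulr1 addr0.
  by rewrite !mxE eq_sym ik mulr0.
by rewrite big1 => [|i _]; rewrite ?scaler0// addr0 /GRing.scale /= mulr1.
Qed.

Lemma explicit_field_vector_field : vector_field Om V.
Proof.
split; last exact: explicit_field_out.
move=> k; have := @smooth_eval_sum R _ _ crd (over Om) pos' crd_linear crd_continuous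
  crd_pos (open_over openOm) _ _ fields directions wf_fields k.
apply: eq_on_open_Ck; first exact: open_over.
move=> z Omz; rewrite sum_fields explicit_fieldE//.
by congr (_, _); [apply/rowP => l; rewrite !mxE|]; rewrite /= eval_map_expr.
Qed.

Lemma derive_explicit_field z w : over Om z ->
  'D_w V z = (\row_k eval (z.1 0) (diff (w.1 0) (xi k)),
    eval (z.1 0) (diff (w.1 0) lam) * z.2 + eval (z.1 0) lam * w.2).
Proof.
move=> Omz; rewrite (@eq_on_open_derive _ _ _ _ V (fun z =>
  \sum_(i < n.+1) eval (crd^~ z) (fields i) *: directions i) _ _ (open_over openOm) Omz).
  have [_ ->] := @is_derive_eval_sum R _ _ crd (over Om) pos' crd_linear
    crd_pos _ _ fields directions z w Omz wf_fields.
  rewrite (sum_fields (fun e => eval (crd^~ z) (diff (crd^~ w) e))).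
  congr (_, _); last by rewrite /= diff_map_expr !eval_map_expr.
  by apply/rowP => l; rewrite !mxE diff_map_expr eval_map_expr.
move=> q Omq; rewrite (sum_fields (fun e => eval (crd^~ q) e)) explicit_fieldE//.
by congr (_, _); [apply/rowP => l; rewrite !mxE|]; rewrite /= eval_map_expr.
Qed.

End OneField.

(** The u-components of the two derivatives both contain the product lam1 lam2 u, which cancels;
    what is left is the bracket of the base fields together with X1 lam2 - X2 lam1. Outside the
    domain all fields vanish, so the bracket does too. *)
Lemma bracket_explicit_field xi1 lam1 xi2 lam2 xi3 lam3 :
  (forall k, wf pos (xi1 k)) -> wf pos lam1 ->
  (forall k, wf pos (xi2 k)) -> wf pos lam2 ->
  (forall p, Om p ->
    let X1 k := eval (p 0) (xi1 k) in let X2 k := eval (p 0) (xi2 k) in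
    (forall k, eval (p 0) (diff X1 (xi2 k)) - eval (p 0) (diff X2 (xi1 k)) =
      eval (p 0) (xi3 k)) /\
    eval (p 0) (diff X1 lam2) - eval (p 0) (diff X2 lam1) = eval (p 0) lam3) ->
  field_bracket (explicit_field xi1 lam1) (explicit_field xi2 lam2) =
    explicit_field xi3 lam3.
Proof.
move=> w1 wl1 w2 wl2 E; apply/funext => z; rewrite /field_bracket.
have [Omz|Omz] := pselect (over Om z); last first.
  by rewrite !explicit_field_out// !derive0 subr0.
rewrite !derive_explicit_field// !explicit_fieldE//=.
have [Ex El] := E z.1 Omz.
have rowE xi (k : 'I_n) : (\row_k eval (z.1 0) (xi k)) 0 k = eval (z.1 0) (xi k).
  by rewrite mxE.
rewrite -El; congr (_, _).
  apply/rowP => k; rewrite !mxE -Ex.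
  by rewrite (eq_diff _ (rowE xi1)) (eq_diff _ (rowE xi2)).
rewrite /= (eq_diff _ (rowE xi1)) (eq_diff _ (rowE xi2)); ring.
Qed.

End ExplicitFields.

(** * The six-parameter family consists of symmetries and exhausts them *)

Section ExplicitXYT.
Variables (R : realType) (a b : R).
Hypothesis bn0 : b != 0.

Definition pos_y (i : 'I_3) := i == iy.

Lemma quadrant_pos i (p : 'rV[R]_3) : pos_y i -> quadrant p -> 0 < p 0 i.
Proof. by move=> /eqP -> []. Qed.

Definition field_xyt_of (w : 'rV[R]_6) : field R 3 :=
  explicit_field quadrant (xi_xyt b w) (lam_xyt a b w).

Lemma wf_xi_xyt w k : wf pos_y (xi_xyt b w k).
Proof. by case: (ord_xyt k) => ->. Qed.

Lemma wf_lam_xyt w : wf pos_y (lam_xyt a b w).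
Proof. by []. Qed.

Lemma unit_xyt : ((unit_vector R ix ix = 1) * (unit_vector R iy iy = 1) *
  (unit_vector R it it = 1) * (unit_vector R ix iy = 0) * (unit_vector R ix it = 0) *
  (unit_vector R iy ix = 0) * (unit_vector R iy it = 0) *
  (unit_vector R it ix = 0) * (unit_vector R it iy = 0))%type.
Proof. by []. Qed.

Lemma determining_xyt_eval (X : 'I_3 -> expr R 'I_3) (lam : expr R 'I_3) :
  (forall k, wf pos_y (X k)) -> wf pos_y lam ->
  (forall p, quadrant p ->
    let x := p 0 ix in let y := p 0 iy in
    let A := a - b * x in let B := 1 / 4 - (- b) * y in
    let T := X it in let Y := X iy in let X := X ix in
    let D e i := diff (unit_vector R i) e in let ev := eval (p 0) in
    [/\ ev (D T ix) = 0, ev (D T iy) = 0, x * ev (D Y ix) + y * ev (D X iy) = 0,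
      ev X - 2 * x * ev (D X ix) + x * ev (D T it) = 0 &
      ev Y - 2 * y * ev (D Y iy) + y * ev (D T it) = 0] /\
    [/\ - b * ev X + A * (ev (D T it) - ev (D X ix)) - B * ev (D X iy) - ev (D X it)
        + x * ev (D lam ix) - x / 2 * ev (D (D X ix) ix) - y / 2 * ev (D (D X iy) iy) = 0,
      - - b * ev Y + B * (ev (D T it) - ev (D Y iy)) - A * ev (D Y ix) - ev (D Y it)
        + y * ev (D lam iy) - x / 2 * ev (D (D Y ix) ix) - y / 2 * ev (D (D Y iy) iy) = 0 &
      ev (D lam it) + A * ev (D lam ix) + B * ev (D lam iy)
        + x / 2 * ev (D (D lam ix) ix) + y / 2 * ev (D (D lam iy) iy) = 0]) ->
  determining_xyt a b (1 / 4) (- b)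
    (fun k p => eval (p 0) (X k)) (fun p => eval (p 0) lam).
Proof.
move=> wX wl H p Omp; have := H p Omp; cbv zeta.
have D1 := @partial_eval R 3 _ pos_y quadrant_pos.
have D2 := @partial2_eval R 3 _ pos_y (@open_quadrant R) quadrant_pos.
have dx k i := D1 _ i p Omp (wX k).
have dl i := D1 _ i p Omp wl.
have ddx k i := D2 _ i i p Omp (wX k).
have ddl i := D2 _ i i p Omp wl.
by rewrite !ddx !ddl !dx !dl.
Qed.

Lemma determining_xyt_explicit w : determining_xyt a b (1 / 4) (- b)
  (fun k p => eval (p 0) (xi_xyt b w k)) (fun p => eval (p 0) (lam_xyt a b w)).
Proof.
apply: (determining_xyt_eval (wf_xi_xyt w) (wf_lam_xyt w)) => p Omp.
have [x0 y0] := Omp; cbv zeta.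
have [q [q0 yE sqE]] : exists q, [/\ 0 < q, p 0 iy = q ^+ 2 & Num.sqrt (q ^+ 2) = q].
  exists (Num.sqrt (p 0 iy)).
  by rewrite sqrtr_gt0 y0 sqr_sqrtr ?ltW.
rewrite /= !unit_xyt yE sqE.
(* The determining equations are linear, so they hold separately for each exponential, and the
   exponentials can be treated as unrelated unknowns. *)
move: (expR _) (expR _) (expR _) (expR _) (p 0 ix) x0 (coord6 w) => e1 e2 e3 e4 x x0 c.
have qn0 : q != 0 by rewrite lt0r_neq0.
by do ?split; field; rewrite ?bn0 ?qn0.
Qed.

Lemma field_xyt_of_symmetry w : L_abde a b (1 / 4) (- b) (field_xyt_of w).
Proof.
apply: (@symmetry_determining_xyt R a b (1 / 4) (- b)
  (fun k p => eval (p 0) (xi_xyt b w k)) (fun p => eval (p 0) (lam_xyt a b w))).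
- move=> k; apply: (@smooth_eval R 3 _ pos_y (@open_quadrant R) quadrant_pos).
  exact: wf_xi_xyt.
- by apply: (@smooth_eval R 3 _ pos_y (@open_quadrant R) quadrant_pos).
- by move=> z Omz; rewrite /field_xyt_of explicit_fieldE.
- apply: (@explicit_field_vector_field R 3 _ pos_y (@open_quadrant R) quadrant_pos) => //.
  exact: wf_xi_xyt.
- exact: determining_xyt_explicit.
Qed.

Lemma L_abde_field_xyt_of v : a <> 1 / 4 -> a <> 3 / 4 ->
  L_abde a b (1 / 4) (- b) v -> exists w, v = field_xyt_of w.
Proof.
move=> ha ha' Lv; have [X [lam [Xs ls vE det]]] := L_abde_fibre_linear Lv.
have hb : b <> 0 by apply/eqP.
have [w wE] := determining_xyt_solution ha ha' hb Xs ls det.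
exists w; apply/funext => z.
have [Omz|Omz] := pselect (over quadrant z).
  rewrite /field_xyt_of explicit_fieldE// vE//; have [XE ->] := wE _ Omz.
  by congr (_, _); apply/rowP => k; rewrite !mxE XE.
rewrite /field_xyt_of explicit_field_out//.
by have [[[_ out] _] _] := Lv; exact: out.
Qed.

End ExplicitXYT.

(** * The Lie algebra M *)

Section ModelAlgebra.
Variable R : realType.
Implicit Types u v w : 'rV[R]_6.

Lemma coord6_ord u (i : 'I_6) : u 0 i = coord6 u i.
Proof. by rewrite /coord6 inord_val. Qed.

Lemma coord6D c u v k : coord6 (c *: u + v) k = c * coord6 u k + coord6 v k.
Proof. by rewrite /coord6 !mxE. Qed.

Lemma coord60 k : coord6 (0 : 'rV[R]_6) k = 0.
Proof. by rewrite /coord6 mxE. Qed.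

Lemma coord6Z c u k : coord6 (c *: u) k = c * coord6 u k.
Proof. by rewrite /coord6 mxE. Qed.

Lemma coord6N u k : coord6 (- u) k = - coord6 u k.
Proof. by rewrite /coord6 mxE. Qed.

Lemma coord6A u v k : coord6 (u + v) k = coord6 u k + coord6 v k.
Proof. by rewrite /coord6 mxE. Qed.

Lemma coord6_basis j k : (j < 6)%N -> (k < 6)%N ->
  coord6 (M_basis R j) k = (k == j)%:R.
Proof. by move=> j6 k6; rewrite /coord6 mxE eqxx -[inord k == _]val_eqE /= !inordK. Qed.

Lemma row6P u v : (forall k, (k < 6)%N -> coord6 u k = coord6 v k) -> u = v.
Proof. by move=> uv; apply/rowP => i; rewrite !coord6_ord; exact: uv. Qed.

Lemma sum6 (V : nmodType) (f : nat -> V) :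
  \sum_(i < 6) f i = f 0%N + f 1%N + f 2%N + f 3%N + f 4%N + f 5%N.
Proof. by rewrite !big_ord_recr big_ord0 /= add0r. Qed.

Definition M_bracket_coord (u v : nat -> R) (k : nat) : R :=
  nth 0 [::
    2 * (u 2 * v 0 - u 0 * v 2);
    - 2 * (u 2 * v 1 - u 1 * v 2);
    u 0 * v 1 - u 1 * v 0;
    (u 0 * v 4 - u 4 * v 0) + (u 2 * v 3 - u 3 * v 2);
    (u 1 * v 3 - u 3 * v 1) - (u 2 * v 4 - u 4 * v 2);
    u 3 * v 4 - u 4 * v 3] k.

Lemma coord6_M_bracket u v k : (k < 6)%N ->
  coord6 (M_bracket u v) k = M_bracket_coord (coord6 u) (coord6 v) k.
Proof.
move=> k6; pose s i j := (coord6 u i * coord6 v j - coord6 u j * coord6 v i) *: M_table R i j.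
have -> : M_bracket u v = \sum_(i < 6) \sum_(j < 6) s i j.
  by apply: eq_bigr => i _; apply: eq_bigr => j _; rewrite !coord6_ord.
rewrite (sum6 (fun i => \sum_(j < 6) s i j)).
rewrite (sum6 (s 0%N)) (sum6 (s 1%N)) (sum6 (s 2%N)) (sum6 (s 3%N)) (sum6 (s 4%N))
  (sum6 (s 5%N)) /s.
rewrite /M_table !scaler0 !(coord6A, coord6Z, coord6N, coord60).
rewrite !coord6_basis//.
by case: k k6 => [|[|[|[|[|[|//]]]]]] _ /=; rewrite /M_bracket_coord /=; ring.
Qed.

Lemma M_is_lie_algebra : is_lie_algebra [set: 'rV[R]_6] (@M_bracket R).
Proof.
split=> //.
- move=> c u v w _ _ _; split; apply: row6P => k k6;
    rewrite !(coord6D, coord6_M_bracket)// /M_bracket_coord !coord6D;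
    case: k k6 => [|[|[|[|[|[|//]]]]]] _ /=; ring.
- split=> [u _|u v w _ _ _]; apply: row6P => k k6;
    rewrite !(coord6A, coord60, coord6_M_bracket)// /M_bracket_coord;
    case: k k6 => [|[|[|[|[|[|//]]]]]] _ /=; rewrite ?coord6_M_bracket//
    /M_bracket_coord /=; ring.
Qed.

(** * Transport of the structure of M along a linear bijection *)

Section Transfer.
Variables (V : lmodType R) (A : set V) (br : V -> V -> V) (F : 'rV[R]_6 -> V).
Hypotheses (F_linear : forall c u v, F (c *: u + v) = c *: F u + F v)
  (F_inj : injective F) (F_in : forall u, A (F u))
  (F_surj : forall x : V, A x -> exists u, x = F u)
  (F_bracket : forall u v, br (F u) (F v) = F (M_bracket u v)).

Lemma transfer_lie_algebra : is_lie_algebra A br.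
Proof.
have F0 : F 0 = 0 by have := F_linear (-1) 0 0; rewrite scaler0 addr0 scaleN1r addNr.
have FD u v : F (u + v) = F u + F v by rewrite -{1}[u]scale1r F_linear scale1r.

have [_ _ _ M_bil [M_alt M_jac]] := M_is_lie_algebra.
split.
- by rewrite -F0.
- by move=> c _ _ /F_surj[u ->] /F_surj[v ->]; rewrite -F_linear.
- by move=> _ _ /F_surj[u ->] /F_surj[v ->]; rewrite F_bracket.
- move=> c _ _ _ /F_surj[u ->] /F_surj[v ->] /F_surj[w ->].
  have [e1 e2] := M_bil c u v w I I I.
  by rewrite -!F_linear !F_bracket -!F_linear e1 e2.
- split=> [_ /F_surj[u ->]|_ _ _ /F_surj[u ->] /F_surj[v ->] /F_surj[w ->]].
    by rewrite F_bracket M_alt.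
  by rewrite !F_bracket -!FD M_jac.
Qed.

Lemma transfer_isomorphic_from : lie_isomorphic [set: 'rV[R]_6] (@M_bracket R) A br.
Proof.
split; [exact: M_is_lie_algebra|exact: transfer_lie_algebra|].
exists F; split=> [|c u v _ _|u v _ _]; rewrite ?F_bracket//.
split=> [u _|u v _ _|v /F_surj[u ->]]; [exact: F_in|exact: F_inj|by exists u].
Qed.

Lemma transfer_isomorphic_to : lie_isomorphic A br [set: 'rV[R]_6] (@M_bracket R).
Proof.
split; [exact: transfer_lie_algebra|exact: M_is_lie_algebra|].
have [G FK] : exists G : V -> 'rV[R]_6, cancel F G.
  (* A chosen preimage under F; outside the image of F, which is A, the default value 0 is taken. *)
  exists (fun x : V => xget 0 [set u | x = F u]) => u.
  have /F_inj/esym// : F u = F (xget 0 [set w | F u = F w]).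
  exact: (@xgetPex _ 0 [set w | F u = F w] (ex_intro _ u erefl)).
exists G; split.
- split=> //.
    by move=> x y /set_mem/F_surj[u ->] /set_mem/F_surj[u' ->]; rewrite !FK => ->.
  by move=> u _; exists (F u).
- by move=> c _ _ /F_surj[u ->] /F_surj[v ->]; rewrite -F_linear !FK.
- by move=> _ _ /F_surj[u ->] /F_surj[v ->]; rewrite F_bracket !FK.
Qed.
End Transfer.
End ModelAlgebra.

(** * Bracket, linear independence and the basis v1, ..., v6 *)

Section LieAlgebraXYT.
Variables (R : realType) (a b : R).
Hypothesis bn0 : b != 0.

Local Notation F := (field_xyt_of a b).

(** Brackets multiply exponentials, so their relations now matter: as powers of h = exp(bt/2) they
    become rational and fall within the reach of [field]. *)
Lemma expR_powers (t : R) : exists2 h : R, h != 0 &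
  [/\ expR (b / 2 * t) = h, expR (b * t) = h ^+ 2,
      expR (- (b / 2) * t) = h^-1 & expR (- b * t) = h^-1 ^+ 2].
Proof.
exists (expR (b / 2 * t)); first by rewrite gt_eqF// expR_gt0.
have hN : expR (- (b / 2) * t) = (expR (b / 2 * t))^-1 by rewrite mulNr expRN.
split=> //; first by rewrite -expRM_natl; congr expR; field.
by rewrite -hN -expRM_natl; congr expR; field.
Qed.

Lemma bracket_field_xyt_of u v :
  field_bracket (F u) (F v) = F (M_bracket u v).
Proof.
apply: (@bracket_explicit_field R 3 quadrant pos_y (@open_quadrant R) (@quadrant_pos R)).
- exact: wf_xi_xyt.
- by [].
- exact: wf_xi_xyt.
- by [].
move=> p [x0 y0]; cbv zeta.
have [q [q0 yE sqE]] : exists q, [/\ 0 < q, p 0 iy = q ^+ 2 & Num.sqrt (q ^+ 2) = q].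
  exists (Num.sqrt (p 0 iy)).
  by rewrite sqrtr_gt0 y0 sqr_sqrtr ?ltW.
have [h h0 [e1 e2 e3 e4]] := expR_powers (p 0 it).
have qn0 : q != 0 by rewrite lt0r_neq0.
split.
  move=> k; case: (ord_xyt k) => ->; rewrite /= !coord6_M_bracket// ?yE ?sqE ?e1 ?e2 ?e3 ?e4;
  rewrite /M_bracket_coord /=;
  move: (p 0 ix) (coord6 u) (coord6 v) => x {}u {}v.
  - by field; rewrite ?bn0 ?qn0 ?h0.
  - by field; rewrite ?bn0 ?qn0 ?h0.
  - by field; rewrite ?bn0 ?qn0 ?h0.
rewrite /= !coord6_M_bracket// yE sqE e1 e2 e3 e4 /M_bracket_coord /=.
move: (p 0 ix) (coord6 u) (coord6 v) => x {}u {}v.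
by field; rewrite ?bn0 ?qn0 ?h0.
Qed.

Lemma linear_field_xyt_of c u v : F (c *: u + v) = c *: F u + F v.
Proof.
apply/funext => z; rewrite !fctE.
have [Omz|Omz] := pselect (over quadrant z); last first.
  by rewrite /field_xyt_of !explicit_field_out// scaler0 addr0.
rewrite /field_xyt_of !explicit_fieldE//.
move: (z.1) (z.2) => p s.
apply/pair_equal_spec; split.
  apply/rowP => k; rewrite !mxE.
  by case: (ord_xyt k) => ->; rewrite /= !coord6D /GRing.scale /=; ring.
rewrite /= !coord6D /GRing.scale /=.
by move: (expR _) (expR _) (expR _) (p 0 ix) (p 0 iy) => *; ring.
Qed.

(** It suffices to evaluate at x = y = u = 1 and at the two times t = 0 and t = 1. *)
Lemma field_xyt_of_eq0 u : F u = 0 -> u = 0.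
Proof.
move=> Fu.
have E t : [/\ coord6 u 0 * expR (b * t) + coord6 u 1 * expR (- b * t) = 0,
    coord6 u 3 * expR (b / 2 * t) - coord6 u 4 * expR (- (b / 2) * t) = 0,
    coord6 u 0 * expR (b * t) - coord6 u 1 * expR (- b * t) + 2 * coord6 u 2 = 0 &
    eval ((row3 1 1 t) 0) (lam_xyt a b u) = 0].
  have Om1 : over quadrant ((row3 1 1 t, 1) : jet0 R 3) by exact: quadrant_row3.
  have := congr1 (fun v => v (row3 1 1 t, 1)) Fu.
  rewrite /field_xyt_of explicit_fieldE// => /pair_equal_spec[/rowP Ex].
  rewrite /= mulr1 => El.
  have := Ex ix; have := Ex iy; have := Ex it; rewrite !mxE /= !mxE /=.
  rewrite sqrtr1 invr1 !mul1r => e3 e2 e1.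
  have {}e3 := congr1 ( *%R^~ b) e3.
  split.
  - exact: e1.
  - by move: e2; rewrite e1 add0r mulNr.
  - rewrite -[RHS](mul0r b) -e3; field; exact: bn0.
  - by move: El; rewrite !mxE /= sqrtr1 invr1 !mul1r.
have [] := E 0; rewrite !mulr0 expR0 !mulr1 => a1 a2 a3 a4.
have [b1 b2 _ _] := E 1; rewrite !mulr1 in b1 b2.
move=> {E}.
(* This is the determinant of the system formed by the values at t = 0 and t = 1 of a combination of
   exp(ct) and exp(-ct); it is used for c = b and c = b/2. *)
have neq c : c != 0 -> expR (- c) - expR c != 0 :> R.
  move=> /eqP c0; apply/eqP => /subr0_eq/expR_inj E; apply: c0; lra.
have c1 : coord6 u 1 = 0.
  apply: (mulIf (neq b bn0)); rewrite mul0r.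
  have -> : coord6 u 1 * (expR (- b) - expR b) = (coord6 u 0 * expR b +
    coord6 u 1 * expR (- b)) - (coord6 u 0 + coord6 u 1) * expR b by ring.
  by rewrite b1 a1 mul0r subrr.
have b20 : b / 2 != 0 by rewrite mulf_neq0// invr_neq0.
have c4 : coord6 u 4 = 0.
  apply: (mulIf (neq _ b20)); rewrite mul0r.
  have -> : coord6 u 4 * (expR (- (b / 2)) - expR (b / 2)) =
    (coord6 u 3 - coord6 u 4) * expR (b / 2) - (coord6 u 3 * expR (b / 2) -
    coord6 u 4 * expR (- (b / 2))) by ring.
  by rewrite b2 a2 mul0r subrr.
have c0 : coord6 u 0 = 0 by move: a1; rewrite c1 addr0.
have c3 : coord6 u 3 = 0 by move: a2; rewrite c4 subr0.
have c2 : coord6 u 2 = 0 by move: a3; rewrite c0 c1 => a3; lra.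
have c5 : coord6 u 5 = 0.
  apply: (mulfI bn0); rewrite mulr0 -[RHS]a4 /= c0 c1 c2 c4; ring.
apply: row6P => k k6; rewrite coord60.
by case: k k6 => [|[|[|[|[|[|//]]]]]].
Qed.

Lemma field_xyt_of_inj : injective F.
Proof.
move=> u v Fuv; apply/eqP; rewrite -subr_eq0; apply/eqP/field_xyt_of_eq0.
by rewrite addrC -scaleN1r linear_field_xyt_of Fuv scaleN1r addNr.
Qed.

Lemma field_xytu_field_xyt_of xi gamma tau phi w :
  (forall x q t s, 0 < q -> Num.sqrt (q ^+ 2) = q ->
    let y := q ^+ 2 in let p := row3 x y t in
    [/\ xi x y t s = eval (p 0) (xi_xyt b w ix),
      gamma x y t s = eval (p 0) (xi_xyt b w iy),
      tau x y t s = eval (p 0) (xi_xyt b w it) &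
      phi x y t s = eval (p 0) (lam_xyt a b w) * s]) ->
  field_xytu xi gamma tau phi = F w.
Proof.
move=> E; apply/funext => z; have [Omz|Omz] := pselect (over quadrant z); last first.
  by rewrite /field_xyt_of explicit_field_out// /field_xytu /ext0 /patch memNset.
rewrite /field_xyt_of explicit_fieldE// /field_xytu /ext0 /patch mem_set//.
have [x0 y0] := Omz; rewrite [in RHS](row3_eta z.1).
have q0 : 0 < Num.sqrt (z.1 0 iy) by rewrite sqrtr_gt0.
have := E (z.1 0 ix) _ (z.1 0 it) z.2 q0; rewrite sqr_sqrtr ?ltW//.
move=> /(_ erefl)[e1 e2 e3 ->].
congr (_, _); apply/rowP => k; rewrite !mxE.
by case: (ord_xyt k) => -> /=.
Qed.

Lemma v1_field_xyt_of : v1 a b = F (b *: M_basis R 0).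
Proof.
apply: field_xytu_field_xyt_of => x q t s q0 sqE y p; rewrite /p /y.
rewrite /= !mxE /= !coord6Z !coord6_basis//= sqE ?mulNr.
by split; field; rewrite ?bn0 ?lt0r_neq0.
Qed.

Lemma v2_field_xyt_of : v2 b = F (- b *: M_basis R 1).
Proof.
apply: field_xytu_field_xyt_of => x q t s q0 sqE y p; rewrite /p /y.
rewrite /= !mxE /= !coord6Z !coord6_basis//= sqE ?mulNr.
by split; field; rewrite ?bn0 ?lt0r_neq0.
Qed.

Lemma v3_field_xyt_of : v3 a b = F ((b / 2) *: M_basis R 2).
Proof.
apply: field_xytu_field_xyt_of => x q t s q0 sqE y p; rewrite /p /y.
rewrite /= !mxE /= !coord6Z !coord6_basis//= sqE ?mulNr.
by split; field; rewrite ?bn0 ?lt0r_neq0.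
Qed.

Lemma v4_field_xyt_of : v4 b = F (- 1 *: M_basis R 4).
Proof.
apply: field_xytu_field_xyt_of => x q t s q0 sqE y p; rewrite /p /y.
rewrite /= !mxE /= !coord6Z !coord6_basis//= sqE ?mulNr.
by split; field; rewrite ?bn0 ?lt0r_neq0.
Qed.

Lemma v5_field_xyt_of : v5 b = F (1 *: M_basis R 3).
Proof.
apply: field_xytu_field_xyt_of => x q t s q0 sqE y p; rewrite /p /y.
rewrite /= !mxE /= !coord6Z !coord6_basis//= sqE ?mulNr.
by split; field; rewrite ?bn0 ?lt0r_neq0.
Qed.

Lemma v6_field_xyt_of : v6 = F (b^-1 *: M_basis R 5).
Proof.
apply: field_xytu_field_xyt_of => x q t s q0 sqE y p; rewrite /p /y.
rewrite /= !mxE /= !coord6Z !coord6_basis//= sqE ?mulNr.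
by split; field; rewrite ?bn0 ?lt0r_neq0.
Qed.

(** Since v4 is - Y and v5 is X, the coefficients of v4 and v5 change places in the row. *)
Lemma combination_field_xyt_of (c : 'I_6 -> R) :
  let s k := c (inord k) in
  \sum_(i < 6) c i *: tnth [tuple v1 a b; v2 b; v3 a b; v4 b; v5 b; v6] i =
  F (\row_i nth 0 [:: b * s 0%N; - (b * s 1%N); b / 2 * s 2%N; s 4%N; - s 3%N; s 5%N / b] i).
Proof.
move=> s; have F0 : F 0 = 0.
  by have := linear_field_xyt_of (-1) 0 0; rewrite scaler0 addr0 scaleN1r addNr.
have FZ k u : k *: F u = F (k *: u).
  by have := linear_field_xyt_of k u 0; rewrite F0 !addr0.
have FD u v : F u + F v = F (u + v).
  by have := linear_field_xyt_of 1 u v; rewrite !scale1r.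
pose w k := s k *: nth 0 [:: v1 a b; v2 b; v3 a b; v4 b; v5 b; v6] k.
rewrite (eq_bigr (fun i : 'I_6 => w i)) => [|i _]; last first.
  by rewrite (tnth_nth 0) /w /s inord_val.
rewrite (sum6 w) /w /= v1_field_xyt_of v2_field_xyt_of v3_field_xyt_of
  v4_field_xyt_of v5_field_xyt_of v6_field_xyt_of !FZ !FD; congr F.
apply: row6P => k k6; rewrite !(coord6A, coord6Z) !coord6_basis//.
rewrite /coord6 mxE inordK//.
by case: k k6 => [|[|[|[|[|[|//]]]]]] _ /=; ring.
Qed.

Lemma basis_L_abde : a <> 1 / 4 -> a <> 3 / 4 ->
  is_basis (L_abde a b (1 / 4) (- b)) [tuple v1 a b; v2 b; v3 a b; v4 b; v5 b; v6].
Proof.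
move=> ha ha'; split.
  apply/seteqP; split=> v; last first.
    by case=> c ->; rewrite combination_field_xyt_of; exact: field_xyt_of_symmetry.
  move=> /(L_abde_field_xyt_of bn0 ha ha')[w ->].
  exists (fun i : 'I_6 => nth 0 [:: coord6 w 0 / b; - coord6 w 1 / b; 2 * coord6 w 2 / b;
    - coord6 w 4; coord6 w 3; b * coord6 w 5] i).
  rewrite combination_field_xyt_of; congr F; apply: row6P => k k6.
  rewrite [RHS]/coord6 mxE !inordK//.
  by case: k k6 => [|[|[|[|[|[|//]]]]]] _ /=; field; rewrite ?bn0.
move=> c; rewrite combination_field_xyt_of => /field_xyt_of_eq0 /rowP c0 i.
have E k : (k < 6)%N -> nth 0 [:: b * c (inord 0); - (b * c (inord 1));
    b / 2 * c (inord 2); c (inord 4); - c (inord 3); c (inord 5) / b] k = 0.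
  by move=> k6; have := c0 (inord k); rewrite !mxE inordK.
have b20 : b / 2 != 0 by rewrite mulf_neq0// invr_neq0.
rewrite -[i]inord_val.
case: i => [[|[|[|[|[|[|//]]]]]] i6] /=.
- by apply: (mulfI bn0); rewrite mulr0; exact: (E 0%N erefl).
- by apply: (mulfI bn0); apply: oppr_inj; rewrite mulr0 oppr0; exact: (E 1%N erefl).
- by apply: (mulfI b20); rewrite mulr0; exact: (E 2%N erefl).
- by apply: oppr_inj; rewrite oppr0; exact: (E 4%N erefl).
- exact: (E 3%N erefl).
- by apply: (mulIf (invr_neq0 bn0)); rewrite mul0r; exact: (E 5%N erefl).
Qed.
End LieAlgebraXYT.

(** * The heat equation *)

Lemma ord_tq (k : 'I_2) : k = heat_t \/ k = heat_q.
Proof. by case: k => [[|[|//]] kn]; [left|right]; apply/val_inj. Qed.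

Lemma sum_tq (V : nmodType) (f : 'I_2 -> V) : \sum_k f k = f heat_t + f heat_q.
Proof.
rewrite !big_ord_recr big_ord0 /= add0r.
by congr (f _ + f _); apply/val_inj.
Qed.

Section HeatEquation.
Variable R : realType.

Definition row2 (t q : R) : 'rV[R]_2 := \row_i nth 0 [:: t; q] i.

Definition hess2 (htq hqq : R) : 'M[R]_2 := \matrix_(i, k)
  nth 0 (nth [::] [:: [:: 0; htq]; [:: htq; hqq]] i) k.

Lemma hess2_sym htq hqq : (hess2 htq hqq)^T = hess2 htq hqq.
Proof.
apply/matrixP => i k; rewrite !mxE.
by case: i k => [[|[|//]] ?] [[|[|//]] ?].
Qed.

Lemma row2_eta (p : 'rV[R]_2) : p = row2 (p 0 heat_t) (p 0 heat_q).
Proof. by apply/rowP => k; rewrite mxE; case: (ord_tq k) => ->. Qed.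

Lemma derive_Delta_heat (j w : jet2 R 2) :
  'D_w (@Delta_heat R) j = w.1.2 0 heat_t + w.2 heat_q heat_q.
Proof.
have [//] : is_derive j w (@Delta_heat R) (w.1.2 0 heat_t + w.2 heat_q heat_q).
apply: (@is_derive_polynomial3 R _ (@Delta_heat R) j w _ 0 0) => h.
by rewrite /Delta_heat /= !mxE; ring.
Qed.

Section FibreConstant.
Variable v : field R 2.
Hypothesis v_sym : symmetry setT (@Delta_heat R) v.

Lemma derive_base_slice (f : jet1 R 2 -> R) (z w : jet0 R 2) p :
  'D_((w, 0) : jet1 R 2) f (z, p) = 'D_w (fun z => f (z, p)) z.
Proof.
have E : (fun h : R => h^-1 *: ((f \o shift (z, p)) (h *: ((w, 0) : jet1 R 2)) - f (z, p)))
    = (fun h : R => h^-1 *: (((fun z => f (z, p)) \o shift z) (h *: w) - f (z, p))).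
  apply/funext => h /=; have -> : h *: ((w, 0) : jet1 R 2) + (z, p) = (h *: w + z, p).
    by apply/pair_equal_spec; split=> //=; rewrite scaler0 add0r.
  by [].
by rewrite /derive E.
Qed.

(** The symmetry condition at the jet with u_t = s, u_q = q, u_tq = c and u_qq = - s; here s, c and
    q are free. *)
Lemma symmetry_heat_jet z (s c q : R) :
  phi1 v heat_t (z, row2 s q) + phi2_base v heat_q (z, row2 s q)
  - s * (pdu (phi v) z - (pdu (xi v heat_t) z * s + pdu (xi v heat_q) z * q))
  - 2 * (c * total0 (xi v heat_t) heat_q (z, row2 s q)
         - s * total0 (xi v heat_q) heat_q (z, row2 s q)) = 0.
Proof.
have [_ vs] := v_sym.
have := vs ((z, row2 s q), hess2 c (- s)) I (hess2_sym _ _).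
rewrite {1}/Delta_heat /= !mxE /= subrr => /(_ erefl).
rewrite derive_Delta_heat /prolong2 /= !mxE phi2_diag !sum_tq !mxE /=.
move: (phi1 _ _ _) (phi2_base _ _ _) (total0 _ _ _) (total0 _ _ _) (pdu _ _) (pdu _ _)
  (pdu _ _) => A B C D P T Q e; rewrite -[RHS]e.
by ring.
Qed.

Lemma total0_heat_t z (s q : R) : total0 (xi v heat_t) heat_q (z, row2 s q) = 0.
Proof.
have e0 := symmetry_heat_jet z s 0 q; have e1 := symmetry_heat_jet z s 1 q.
move: e0 e1; move: (total0 _ _ _) (total0 _ _ _) (phi1 _ _ _) (phi2_base _ _ _).
by move=> A B C D e0 e1; lra.
Qed.

Lemma pdu_heat_t z : pdu (xi v heat_t) z = 0.
Proof.
have := total0_heat_t z 0 1; have := total0_heat_t z 0 0.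
by rewrite /total0 /= !mxE /= mul0r mul1r addr0 => ->; rewrite add0r.
Qed.

(** As the total q-derivative of the t-component vanishes on all first jets, phi^q does not contain
    u_t, and neither do its derivatives along the base and u. *)
Lemma phi2_base_heat z (s s' q : R) :
  phi2_base v heat_q (z, row2 s q) = phi2_base v heat_q (z, row2 s' q).
Proof.
rewrite /phi2_base !derive_base_slice /= !mxE /=.
have -> : (fun z => phi1 v heat_q (z, row2 s q)) =
    (fun z => phi1 v heat_q (z, row2 s' q)).
  apply/funext => w; rewrite /phi1 !sum_tq !total0_heat_t !mul0r !add0r.
  by rewrite /total0 /= !mxE.
by [].
Qed.

(** With a single space variable there is no mixed spatial derivative to compare. The increment of
    the symmetry condition from u_t = 0 to u_t = 1 is used instead; it is affine in u_q, with 2 xi_u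
    as leading coefficient. *)
Lemma pdu_heat_q z : pdu (xi v heat_q) z = 0.
Proof.
have E q : 2 * pdx (xi v heat_q) heat_q z - pdx (xi v heat_t) heat_t z
    + 2 * q * pdu (xi v heat_q) z = 0.
  have e0 := symmetry_heat_jet z 0 0 q; have e1 := symmetry_heat_jet z 1 0 q.
  move: e0 e1; rewrite (phi2_base_heat z 1 0) /phi1 !sum_tq /total0 /= !mxE /=.
  rewrite pdu_heat_t; move: (phi2_base _ _ _) (pdx _ _ _) (pdx _ _ _) (pdx _ _ _)
    (pdx _ _ _) (pdx _ _ _) (pdu _ _) (pdu _ _) => *.
  lra.
have e0 := E 0; have e1 := E 1; lra.
Qed.
End FibreConstant.

Definition determining_tq (X : 'I_2 -> 'rV[R]_2 -> R) (lam : 'rV[R]_2 -> R) :=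
  forall p, let D := @partial R 2 in
  [/\ D (X heat_t) heat_q p = 0,
      2 * D (X heat_q) heat_q p = D (X heat_t) heat_t p,
      2 * D lam heat_q p = D (X heat_q) heat_t p + D (D (X heat_q) heat_q) heat_q p &
      D lam heat_t p + D (D lam heat_q) heat_q p = 0].

Lemma vanishing_coefficients_tq (K c1 c2 c3 c4 : R) :
  (forall u q htq hqq : R,
    K * - hqq - c1 * htq - c2 * hqq + c3 * q + c4 * u = 0) ->
  [/\ c1 = 0, c2 = - K, c3 = 0 & c4 = 0].
Proof.
move=> E; have e1 := E 0 0 1 0; have e2 := E 0 0 0 1.
have e3 := E 0 1 0 0; have e4 := E 1 0 0 0.
by move=> {E}; split; lra.
Qed.

Section FibreLinearHeat.
Variables (X : 'I_2 -> 'rV[R]_2 -> R) (lam : 'rV[R]_2 -> R) (v : field R 2).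
Hypotheses (X_smooth : forall k, smooth_on setT (X k))
  (lam_smooth : smooth_on setT lam).
Hypothesis vE :
  forall z, over setT z -> v z = (\row_k X k z.1, lam z.1 * z.2).

Lemma prolong_Delta_heat (j : jet2 R 2) : j.2^T = j.2 ->
  let p := j.1.1.1 in let q := j.1.2 0 in let H := j.2 in
  let D := @partial R 2 in
  'D_(prolong2 v j) (@Delta_heat R) j =
    lam p * Delta_heat j
    + (- D (X heat_t) heat_t p - D (D (X heat_t) heat_q) heat_q p) * q heat_t
    - 2 * D (X heat_t) heat_q p * H heat_t heat_q
    - 2 * D (X heat_q) heat_q p * H heat_q heat_q
    + (2 * D lam heat_q p - D (X heat_q) heat_t p
       - D (D (X heat_q) heat_q) heat_q p) * q heat_q
    + (D lam heat_t p + D (D lam heat_q) heat_q p) * j.1.1.2.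
Proof.
move=> Hsym p q H D.
have Hqt : j.2 heat_q heat_t = j.2 heat_t heat_q by rewrite -{1}Hsym mxE.
rewrite derive_Delta_heat /prolong2 /= !mxE.
rewrite (phi2_fibre_linear openT X_smooth lam_smooth vE)//.
rewrite (phi1_fibre_linear openT X_smooth lam_smooth vE)//.
rewrite !sum_tq Hqt /Delta_heat /D /p /q /H.
by move: (@partial R 2) => D0; ring.
Qed.

Lemma determining_tq_symmetry : linear_symmetry setT (@Delta_heat R) v ->
  determining_tq X lam.
Proof.
case=> -[_ vsym] _.
have E p : forall u q htq hqq : R, let D := @partial R 2 in
    (- D (X heat_t) heat_t p - D (D (X heat_t) heat_q) heat_q p) * - hqq
    - 2 * D (X heat_t) heat_q p * htq - 2 * D (X heat_q) heat_q p * hqq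
    + (2 * D lam heat_q p - D (X heat_q) heat_t p
       - D (D (X heat_q) heat_q) heat_q p) * q
    + (D lam heat_t p + D (D lam heat_q) heat_q p) * u = 0.
  move=> u q htq hqq.
  have J0 : Delta_heat (((p, u), row2 (- hqq) q), hess2 htq hqq) = 0.
    by rewrite /Delta_heat /= !mxE /= addNr.
  have := vsym (((p, u), row2 (- hqq) q), hess2 htq hqq) I (hess2_sym _ _) J0.
  by rewrite prolong_Delta_heat ?J0 ?mulr0 ?add0r /= ?mxE//; exact: hess2_sym.
have Tq p : partial (X heat_t) heat_q p = 0.
  have [/eqP + _ _ _] := vanishing_coefficients_tq (E p).
  by rewrite mulf_eq0 pnatr_eq0 => /eqP.
move=> p; cbv zeta; have [_ e2 e3 e4] := vanishing_coefficients_tq (E p).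
have Tqq : partial (partial (X heat_t) heat_q) heat_q p = 0.
  exact: (@partial_eq0 _ _ _ openT _ _ _ I (fun q _ => Tq q)).
split; [exact: Tq| | |exact: e4].
  by rewrite e2 Tqq subr0 opprK.
by move/eqP: e3; rewrite -addrA -opprD subr_eq0 => /eqP.
Qed.

Lemma symmetry_determining_tq : vector_field setT v ->
  determining_tq X lam -> linear_symmetry setT (@Delta_heat R) v.
Proof.
move=> vv det; split; last by exists lam => z Omz; rewrite /phi vE.
split=> // j _ Hsym j0; rewrite prolong_Delta_heat// j0.
have [e1 e2 e3 e4] := det j.1.1.1; cbv zeta.
have Tqq : partial (partial (X heat_t) heat_q) heat_q j.1.1.1 = 0.
  apply: (@partial_eq0 _ _ _ openT _ _ _ I) => q _; by have [] := det q.
move: e2 e3 e4 j0; rewrite e1 Tqq /Delta_heat.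
move: (j.1.2 0 heat_t) (partial _ _ _) (partial _ _ _) (partial _ _ _) (partial _ _ _)
  (partial _ _ _) (partial _ _ _).
move=> r D1 D2 D3 D4 D5 D6 <- e3 -> e5.
have -> : 2 * D4 - D3 - D2 = 0 by rewrite e3; ring.
have -> : r = - j.2 heat_q heat_q by apply/eqP; rewrite -addr_eq0 e5.
by ring.
Qed.
End FibreLinearHeat.

Lemma H00_fibre_linear (v : field R 2) : H00 v ->
  exists (X : 'I_2 -> 'rV[R]_2 -> R) (lam : 'rV[R]_2 -> R),
  [/\ forall k, smooth_on setT (X k), smooth_on setT lam,
    (forall z, over setT z -> v z = (\row_k X k z.1, lam z.1 * z.2)) &
    determining_tq X lam].
Proof.
move=> Lv; have [vs [mu muE]] := Lv; have [[v_smooth _] _] := vs.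
have oq := @openT 'rV[R]_2.
have xi0 k z : over setT z -> pdu (xi v k) z = 0.
  by move=> _; case: (ord_tq k) => ->; [exact: pdu_heat_t|exact: pdu_heat_q].
have vE := fibre_linear_coordinates oq v_smooth xi0 muE.
exists (fun k x => xi v k (x, 0)), (fun x => phi v (x, 1)).
have Xs k : smooth_on setT (fun x => xi v k (x, 0)).
  exact: (smooth_slice oq 0 (smooth_xi oq v_smooth k)).
have ls : smooth_on setT (fun x => phi v (x, 1)).
  exact: (smooth_slice oq 1 (smooth_phi oq v_smooth)).
by split=> //; exact: determining_tq_symmetry Xs ls vE Lv.
Qed.

Lemma is_derive_in_heat_t (F : 'rV[R]_2 -> R) (t q : R) : smooth_on setT F ->
  is_derive t 1 (fun t => F (row2 t q)) (partial F heat_t (row2 t q)).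
Proof.
move=> Fs.
apply: (@is_derive_comp_affine _ _ _ _ (fun t => row2 t q) F _ _ (delta_mx 0 heat_t)).
  move=> h; apply/rowP => k; rewrite !mxE.
  by case: (ord_tq k) => -> /=; rewrite ?mulr0 ?mulr1 ?add0r // /GRing.scale /= mulr1.
exact: (smooth_is_derive _ Fs I).
Qed.

Lemma is_derive_in_heat_q (F : 'rV[R]_2 -> R) (t q : R) : smooth_on setT F ->
  is_derive q 1 (fun q => F (row2 t q)) (partial F heat_q (row2 t q)).
Proof.
move=> Fs.
apply: (@is_derive_comp_affine _ _ _ _ (fun q => row2 t q) F _ _ (delta_mx 0 heat_q)).
  move=> h; apply/rowP => k; rewrite !mxE.
  by case: (ord_tq k) => -> /=; rewrite ?mulr0 ?mulr1 ?add0r // /GRing.scale /= mulr1.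
exact: (smooth_is_derive _ Fs I).
Qed.
End HeatEquation.

(** * Solution of the determining equations of the heat equation *)

Section SolveHeat.
Variable R : realType.

(** Together with [lam_tq] this realizes M by the classical symmetries: E is the projective field
    t^2 d_t + t q d_q + (q^2/4 - t/2) u d_u, F = - d_t, H = 2 t d_t + q d_q - u/2 d_u is the
    dilation, X = t d_q + q/2 u d_u the Galilean boost, Y = - d_q and Z = u/2 d_u. *)
Definition xi_tq (w : 'rV[R]_6) (k : 'I_2) : expr R 'I_2 :=
  let c := coord6 w in let t := Crd heat_t in let q := Crd heat_q in
  nth (Cst 0) [::
    ((c 0%N)%:C * (t * t) + (2 * c 2%N)%:C * t + (- c 1%N)%:C)%X;
    ((c 0%N)%:C * (t * q) + (c 2%N)%:C * q + (c 3%N)%:C * t + (- c 4%N)%:C)%X] k.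

Definition lam_tq (w : 'rV[R]_6) : expr R 'I_2 :=
  let c := coord6 w in let t := Crd heat_t in let q := Crd heat_q in
  ((c 0%N / 4)%:C * (q * q) + (- c 0%N / 2)%:C * t + (c 3%N / 2)%:C * q
   + ((c 5%N - c 2%N) / 2)%:C)%X.

Variables (X : 'I_2 -> 'rV[R]_2 -> R) (lam : 'rV[R]_2 -> R).
Hypotheses (X_smooth : forall k, smooth_on setT (X k))
  (lam_smooth : smooth_on setT lam).
Hypothesis det : determining_tq X lam.

Local Notation D := (@partial R 2).
Local Notation pt := (@row2 R).
Local Notation tau t := (X heat_t (pt t 0)).
Local Notation tau1 t := (D (X heat_t) heat_t (pt t 0)).
Local Notation tau2 t := (D (D (X heat_t) heat_t) heat_t (pt t 0)).
Local Notation tau3 t := (D (D (D (X heat_t) heat_t) heat_t) heat_t (pt t 0)).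
Local Notation g t := (X heat_q (pt t 0)).
Local Notation g1 t := (D (X heat_q) heat_t (pt t 0)).
Local Notation g2 t := (D (D (X heat_q) heat_t) heat_t (pt t 0)).

Let dX k (t q : R) := is_derive_in_heat_t t q (X_smooth k).
Let dX1 k (t q : R) := is_derive_in_heat_t t q (smooth_partial heat_t (X_smooth k)).

Lemma heat_tau_of_t t q : X heat_t (pt t q) = tau t.
Proof.
apply: (@derive0_constant R (fun q => X heat_t (pt t q))) => z.
have [<- _ _ _] := det (pt t z); exact: is_derive_in_heat_q.
Qed.

Lemma heat_tau1_of_t t q : D (X heat_t) heat_t (pt t q) = tau1 t.
Proof.
have H s : X heat_t (pt s q) = tau s by exact: heat_tau_of_t.
exact: is_derive_unique H (dX heat_t t q) (dX heat_t t 0).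
Qed.

Lemma heat_xi_formula t q : X heat_q (pt t q) = q * (tau1 t / 2) + g t.
Proof.
have d (z : R) : is_derive z 1 (fun q => X heat_q (pt t q) - q * (tau1 t / 2)) 0.
  apply: is_derive_eq (is_deriveB (is_derive_in_heat_q t z (X_smooth heat_q))
    (is_derive_mulr (tau1 t / 2) (is_derive_id z 1))) _.
  have [_ e _ _] := det (pt t z); move: e; rewrite heat_tau1_of_t => <-.
  by field.
have := derive0_constant d q.
by rewrite mul0r subr0 => <-; ring.
Qed.

Lemma heat_xi_t t q : D (X heat_q) heat_t (pt t q) = q * (tau2 t / 2) + g1 t.
Proof.
have H s : X heat_q (pt s q) = (q / 2 \*: (fun t => tau1 t) + (fun t => g t)) s.
  by rewrite heat_xi_formula !fctE /GRing.scale /= /GRing.scale /=; field.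
rewrite (is_derive_unique H (dX heat_q t q)
  (is_deriveD (is_deriveZ (q / 2) (dX1 heat_t t 0)) (dX heat_q t 0))).
by rewrite /GRing.scale /=; field.
Qed.

Lemma heat_lam_q t q : D lam heat_q (pt t q) = q * (tau2 t / 4) + g1 t / 2.
Proof.
have xi_qq : D (D (X heat_q) heat_q) heat_q (pt t q) = 0.
  have xs : smooth_on setT (D (X heat_q) heat_q) by exact: smooth_partial.
  have H s : D (X heat_q) heat_q (pt t s) = cst (tau1 t / 2) s.
    have [_ e _ _] := det (pt t s); move: e; rewrite heat_tau1_of_t => <- /=.
    by field.
  exact: is_derive_unique H (is_derive_in_heat_q t q xs) (is_derive_cst _ q 1).
have [_ _ e _] := det (pt t q); move: e; rewrite xi_qq heat_xi_t.
move: (D _ _ _) (tau2 t) (g1 t) => *; lra.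
Qed.

Lemma heat_lam_formula t q :
  lam (pt t q) = q ^+ 2 * (tau2 t / 8) + q * (g1 t / 2) + lam (pt t 0).
Proof.
have dz (z : R) : is_derive z 1 (fun q => q ^+ 2 * (tau2 t / 8) + q * (g1 t / 2))
    (z * (tau2 t / 4) + g1 t / 2).
  apply: (@is_derive_polynomial3 _ _ _ _ _ _ (tau2 t / 8) 0) => h.
  by rewrite /GRing.scale /=; field.
have d (z : R) : is_derive z 1 (fun q => lam (pt t q)
    - (q ^+ 2 * (tau2 t / 8) + q * (g1 t / 2))) 0.
  apply: is_derive_eq (is_deriveB (is_derive_in_heat_q t z lam_smooth) (dz z)) _.
  by rewrite heat_lam_q subrr.
have := derive0_constant d q.
by rewrite expr0n /= !mul0r addr0 subr0 => <-; ring.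
Qed.

Lemma heat_reduced_odes t :
  [/\ tau3 t = 0, g2 t = 0 & D lam heat_t (pt t 0) = - (tau2 t / 4)].
Proof.
have dT := is_derive_in_heat_t t 0
  (smooth_partial heat_t (smooth_partial heat_t (X_smooth heat_t))).
have lt q : D lam heat_t (pt t q) =
    q ^+ 2 * (tau3 t / 8) + q * (g2 t / 2) + D lam heat_t (pt t 0).
  have H s : lam (pt s q) = (q ^+ 2 / 8 \*: (fun t => tau2 t) +
      q / 2 \*: (fun t => g1 t) + (fun t => lam (pt t 0))) s.
    by rewrite heat_lam_formula !fctE /GRing.scale /= /GRing.scale /=; field.
  rewrite (is_derive_unique H (is_derive_in_heat_t t q lam_smooth) (is_deriveD
    (is_deriveD (is_deriveZ (q ^+ 2 / 8) dT) (is_deriveZ (q / 2) (dX1 heat_q t 0)))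
    (is_derive_in_heat_t t 0 lam_smooth))).
  rewrite /GRing.scale /= /GRing.scale /=.
  by move: (tau3 t) (g2 t) (D lam _ _) => *; field.
have lqq q : D (D lam heat_q) heat_q (pt t q) = tau2 t / 4.
  have ls : smooth_on setT (D lam heat_q) by exact: smooth_partial.
  have H s : D lam heat_q (pt t s) = s * (tau2 t / 4) + g1 t / 2 by exact: heat_lam_q.
  apply: (is_derive_unique H (is_derive_in_heat_q t q ls)).
  apply: (@is_derive_polynomial3 _ _ _ _ _ _ 0 0) => h.
  by rewrite /GRing.scale /=; field.
have E q : q ^+ 2 * (tau3 t / 8) + q * (g2 t / 2) + D lam heat_t (pt t 0)
    + tau2 t / 4 = 0.
  by have [_ _ _ e] := det (pt t q); rewrite -lt -(lqq q).
have e0 := E 0; have e1 := E 1; have e2 := E (-1).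
move: e0 e1 e2; move: (tau3 t) (tau2 t) (g2 t) (D lam _ _) => *.
by split; lra.
Qed.

Lemma determining_tq_solution : exists w : 'rV[R]_6, forall p,
  (forall k, X k p = eval (p 0) (xi_tq w k)) /\ lam p = eval (p 0) (lam_tq w).
Proof.
have dT2 t := is_derive_in_heat_t t 0
  (smooth_partial heat_t (smooth_partial heat_t (X_smooth heat_t))).
have t2E t : tau2 t = tau2 0.
  apply: (@derive0_constant R (fun t => tau2 t)) => {}t.
  by have [e _ _] := heat_reduced_odes t; exact: is_derive_eq (dT2 t) e.
have g1E t : g1 t = g1 0.
  apply: (@derive0_constant R (fun t => g1 t)) => {}t.
  by have [_ e _] := heat_reduced_odes t; exact: is_derive_eq (dX1 heat_q t 0) e.
have integral (f f' : R -> R) c : (forall t : R, is_derive t 1 f (f' t)) ->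
    (forall t, f' t = c) -> forall t, f t = c * t + f 0.
  move=> fd f'E t; have d (s : R) : is_derive s 1 (fun t => f t - t * c) 0.
    apply: is_derive_eq (is_deriveB (fd s) (is_derive_mulr c (is_derive_id s 1))) _.
    by rewrite f'E mul1r subrr.
  have := derive0_constant d t.
  by rewrite mul0r subr0 => <-; ring.
have t1E := integral (fun t => tau1 t) _ _ (fun t => dX1 heat_t t 0) t2E.
have gE := integral (fun t => g t) _ _ (fun t => dX heat_q t 0) g1E.
have tE t : tau t = tau2 0 * t ^+ 2 / 2 + tau1 0 * t + tau 0.
  have ds (s : R) : is_derive s 1 (fun t => t ^+ 2 * (tau2 0 / 2) + t * tau1 0)
      (s * tau2 0 + tau1 0).
    apply: (@is_derive_polynomial3 _ _ _ _ _ _ (tau2 0 / 2) 0) => h.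
    by rewrite /GRing.scale /=; field.
  have d (s : R) :
      is_derive s 1 (fun t => tau t - (t ^+ 2 * (tau2 0 / 2) + t * tau1 0)) 0.
    apply: is_derive_eq (is_deriveB (dX heat_t s 0) (ds s)) _.
    by rewrite t1E; ring.
  have := derive0_constant d t.
  by rewrite expr0n /= !mul0r addr0 subr0 => <-; field.
have lE t : lam (pt t 0) = - (tau2 0 / 4) * t + lam (pt 0 0).
  apply: (integral (fun t => lam (pt t 0)) _ _ (fun t => is_derive_in_heat_t t 0 lam_smooth)).
  by move=> s; have [_ _ ->] := heat_reduced_odes s; rewrite t2E.
(* Taylor coefficients at t = 0 in the normalization of [xi_tq]. The last entry solves (c5 - c2) / 2
   = lam at the origin, as H also has a constant u-component. *)
pose cs := [:: tau2 0 / 2; - tau 0; tau1 0 / 2; g1 0; - g 0; 2 * lam (pt 0 0) + tau1 0 / 2].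
exists (\row_i nth 0 cs i) => p.
have wE j : (j < 6)%N -> coord6 (\row_i nth 0 cs i) j = nth 0 cs j.
  by move=> j6; rewrite /coord6 mxE inordK.
rewrite (row2_eta p); move: (p 0 heat_t) (p 0 heat_q) => t q; split.
  move=> k; case: (ord_tq k) => ->; rewrite /= !mxE /= !wE//=.
    by rewrite heat_tau_of_t tE; field.
  by rewrite heat_xi_formula t1E gE; field.
rewrite /= !mxE /= !wE//= heat_lam_formula t2E g1E lE.
by field.
Qed.
End SolveHeat.

(** * The six-parameter family of the heat equation and its bracket *)

Section LieAlgebraHeat.
Variable R : realType.

Definition field_tq_of (w : 'rV[R]_6) : field R 2 :=
  explicit_field setT (xi_tq w) (lam_tq w).

Local Notation F := field_tq_of.

Lemma no_pos (i : 'I_2) (p : 'rV[R]_2) : pred0 i -> setT p -> 0 < p 0 i.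
Proof. by []. Qed.

Lemma wf_xi_tq (w : 'rV[R]_6) k : @wf R _ pred0 (xi_tq w k).
Proof. by case: (ord_tq k) => ->. Qed.

Lemma wf_lam_tq (w : 'rV[R]_6) : @wf R _ pred0 (lam_tq w).
Proof. by []. Qed.

Lemma unit_tq : ((unit_vector R heat_t heat_t = 1) * (unit_vector R heat_q heat_q = 1) *
  (unit_vector R heat_t heat_q = 0) * (unit_vector R heat_q heat_t = 0))%type.
Proof. by []. Qed.

Lemma determining_tq_eval (X : 'I_2 -> expr R 'I_2) (lam : expr R 'I_2) :
  (forall k, @wf R _ pred0 (X k)) -> @wf R _ pred0 lam ->
  (forall p : 'rV[R]_2, let D e i := diff (unit_vector R i) e in
    let ev := eval (p 0) in
    [/\ ev (D (X heat_t) heat_q) = 0,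
      2 * ev (D (X heat_q) heat_q) = ev (D (X heat_t) heat_t),
      2 * ev (D lam heat_q) =
        ev (D (X heat_q) heat_t) + ev (D (D (X heat_q) heat_q) heat_q) &
      ev (D lam heat_t) + ev (D (D lam heat_q) heat_q) = 0]) ->
  determining_tq (fun k p => eval (p 0) (X k)) (fun p => eval (p 0) lam).
Proof.
move=> wX wl H p; have := H p; cbv zeta.
have D1 := @partial_eval R 2 _ pred0 no_pos.
have D2 := @partial2_eval R 2 _ pred0 openT no_pos.
have dx k i := D1 _ i p I (wX k).
have dl i := D1 _ i p I wl.
have ddx k i := D2 _ i i p I (wX k).
have ddl i := D2 _ i i p I wl.
by rewrite !ddx !ddl !dx !dl.
Qed.

Lemma determining_tq_explicit (w : 'rV[R]_6) :
  determining_tq (fun k p => eval (p 0) (xi_tq w k)) (fun p => eval (p 0) (lam_tq w)).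
Proof.
apply: (determining_tq_eval (wf_xi_tq w) (wf_lam_tq w)) => p; cbv zeta.
rewrite /= !unit_tq; move: (coord6 w) (p 0 heat_t) (p 0 heat_q) => c t q.
by split; field.
Qed.

Lemma field_tq_of_symmetry (w : 'rV[R]_6) : H00 (F w).
Proof.
apply: (@symmetry_determining_tq R
  (fun k p => eval (p 0) (xi_tq w k)) (fun p => eval (p 0) (lam_tq w))).
- move=> k; apply: (@smooth_eval R 2 _ pred0 openT no_pos).
  exact: wf_xi_tq.
- by apply: (@smooth_eval R 2 _ pred0 openT no_pos).
- by move=> z Omz; rewrite /field_tq_of explicit_fieldE.
- apply: (@explicit_field_vector_field R 2 _ pred0 openT no_pos) => //.
  exact: wf_xi_tq.
- exact: determining_tq_explicit.
Qed.

Lemma H00_field_tq_of (v : field R 2) : H00 v -> exists w, v = F w.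
Proof.
move=> Lv; have [X [lam [Xs ls vE det]]] := H00_fibre_linear Lv.
have [w wE] := determining_tq_solution Xs ls det.
exists w; apply/funext => z.
rewrite /field_tq_of explicit_fieldE// vE//; have [XE ->] := wE z.1.
by congr (_, _); apply/rowP => k; rewrite !mxE XE.
Qed.

Lemma bracket_field_tq_of u v : field_bracket (F u) (F v) = F (M_bracket u v).
Proof.
apply: (@bracket_explicit_field R 2 setT pred0 openT no_pos).
- exact: wf_xi_tq.
- by [].
- exact: wf_xi_tq.
- by [].
move=> p _; cbv zeta.
split.
  by move=> k; case: (ord_tq k) => ->; rewrite /= !coord6_M_bracket//
    /M_bracket_coord /=; move: (coord6 u) (coord6 v) => {}u {}v; field => //.
rewrite /= !coord6_M_bracket// /M_bracket_coord /=.
by move: (coord6 u) (coord6 v) => {}u {}v; field.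
Qed.

Lemma linear_field_tq_of c u v : F (c *: u + v) = c *: F u + F v.
Proof.
apply/funext => z; rewrite !fctE /field_tq_of !explicit_fieldE//.
move: (z.1) (z.2) => p s.
apply/pair_equal_spec; split.
  apply/rowP => k; rewrite !mxE.
  by case: (ord_tq k) => ->; rewrite /= !coord6D /GRing.scale /=; ring.
rewrite /= !coord6D /GRing.scale /=; ring.
Qed.

Lemma field_tq_of_eq0 u : F u = 0 -> u = 0.
Proof.
move=> Fu.
have E t q : [/\ eval ((row2 t q) 0) (xi_tq u heat_t) = 0,
    eval ((row2 t q) 0) (xi_tq u heat_q) = 0 & eval ((row2 t q) 0) (lam_tq u) = 0].
  have := congr1 (fun v => v (row2 t q, 1)) Fu.
  rewrite /field_tq_of explicit_fieldE// => /pair_equal_spec[/rowP Ex].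
  rewrite mulr1 => El.
  by split=> //; [have := Ex heat_t|have := Ex heat_q]; rewrite !mxE.
have [a1 a2 a3] := E 0 0; have [b1 b2 _] := E 1 0; have [c1 _ _] := E (-1) 0.
move: a1 a2 a3 b1 b2 c1; rewrite /= !mxE /= => a1 a2 a3 b1 b2 c1.
apply: row6P => k k6; rewrite coord60.
by case: k k6 => [|[|[|[|[|[|//]]]]]] _; lra.
Qed.

Lemma field_tq_of_inj : injective F.
Proof.
move=> u v Fuv; apply/eqP; rewrite -subr_eq0; apply/eqP/field_tq_of_eq0.
by rewrite addrC -scaleN1r linear_field_tq_of Fuv scaleN1r addNr.
Qed.
End LieAlgebraHeat.

(* The hypothesis a <> 3/4 cannot be dropped: for a = 3/4, d = 1/4, e = -b the
   field  sqrt x exp(-bt/2) d/dx - 1/(2 sqrt x) exp(-bt/2) u d/du  is a further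
   symmetry, outside the span of v1, ..., v6. *)
Theorem mainTheorem15 (R : realType) (a b d e : R)
  (ha : a <> 1 / 4) (ha' : a <> 3 / 4) (hd : d = 1 / 4) (hb : b <> 0)
  (he : e = - b) :
  [/\ is_lie_algebra (L_abde a b d e) (@field_bracket R 3),
      is_basis (L_abde a b d e)
        [tuple v1 a b; v2 b; v3 a b; v4 b; v5 b; v6],
      lie_isomorphic (L_abde a b d e) (@field_bracket R 3)
        [set: 'rV[R]_6] (@M_bracket R) &
      lie_isomorphic [set: 'rV[R]_6] (@M_bracket R)
        H00 (@field_bracket R 2)].
Proof.
have bn0 : b != 0 by apply/eqP.
rewrite {}hd {}he.
have surj v := @L_abde_field_xyt_of R a b bn0 v ha ha'.
have lin := linear_field_xyt_of a b.
have inj := @field_xyt_of_inj R a b bn0.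
have sym w : L_abde a b (1 / 4) (- b) (field_xyt_of a b w).
  exact: field_xyt_of_symmetry.
have brk u v := bracket_field_xyt_of a bn0 u v.
split.
- exact: (transfer_lie_algebra lin sym surj brk).
- exact: basis_L_abde.
- exact: (transfer_isomorphic_to lin inj sym surj brk).
- exact: (transfer_isomorphic_from (@linear_field_tq_of R) (@field_tq_of_inj R)
    (@field_tq_of_symmetry R) (@H00_field_tq_of R) (@bracket_field_tq_of R)).
Qed.
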